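(* Let $\mathcal F=\{G_\theta:\theta\in\Theta\}$ be the natural exponential family generated by $\beta=\sum_{k=0}^\infty c_k\delta_k$ with $c_k>0$ for all $k\in\mathbb{N}$, let $\{z_i\}_{i=1}^m$ be independent with CDFs $\{G_{\theta_i}\}_{i=1}^m$ belonging to $\mathcal F$, and let $\rho$ be a finite, positive constant. 1. If there is a constant $C>0$ with $\frac1{c_kk!}\le\frac C{k!}$ for all $k\in\mathbb{N}$, then a uniform consistency class is $$\mathcal Q_{\mathrm{II},1}(\boldsymbol\theta,t,\pi_{1,m};\gamma)=\left\{\begin{array}{c}\|\boldsymbol\theta\|_\infty\le\rho,\ \pi_{1,m}\ge m^{(\gamma-1)/2},\ t=2^{-1}\|\boldsymbol\eta\|_\infty^{-1/2}\gamma\ln m,\\ \lim_{m\to\infty}t\min_{i\in I_{1,m}}|\eta_0-\eta_i|=\infty\end{array}\right\}$$ for any fixed $\gamma\in(0,1]$. The speed of convergence is poly-log. 2. For the Poisson family, a uniform consistency class is $$\mathcal Q_{\mathrm{II},2}(\boldsymbol\theta,t,\pi_{1,m};\gamma)=\left\{\begin{array}{c}\|\boldsymbol\theta\|_\infty\le\rho,\ \pi_{1,m}\ge m^{(\gamma'-1)/2},\ t=\sqrt{\|\boldsymbol\eta\|_\infty^{-1/2}\gamma\ln m},\\ \lim_{m\to\infty}t\min_{i\in I_{1,m}}|\eta_0-\eta_i|=\infty\end{array}\right\}$$ for any fixed $\gamma\in(0,1)$ and $\gamma'>\gamma$. The speed of convergence is poly-log.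
   Context: $\mathbb{N}=\{0,1,2,\dots\}$, $\delta_k$ is the Dirac mass at $k$. $L(\theta)=\int e^{x\theta}\beta(dx)$, $\Theta$ is the maximal open set of $\theta\in\mathbb{R}$ with $L(\theta)<\infty$ (assumed non-empty), $G_\theta(dx)=\exp\{\theta x-\ln L(\theta)\}\beta(dx)$. $H(z)=\sum_{k\ge0}c_kz^k$ is the generating function of $\beta$, so $H^{(k)}(0)=c_kk!$. The Poisson family is the case $c_k=1/k!$, $H(z)=e^z$, $L(\theta)=\exp(e^\theta)$, $\Theta=\mathbb{R}$. $\theta_0\in\Theta$ is fixed; $\mathbf z=(z_1,\dots,z_m)$, $\boldsymbol\theta=(\theta_1,\dots,\theta_m)$, $\eta_i=e^{\theta_i}$ for $0\le i\le m$, $\boldsymbol\eta=(\eta_1,\dots,\eta_m)$, $\|\cdot\|_\infty$ is the maximum norm; $I_{1,m}=\{1\le i\le m:\theta_i\neq\theta_0\}$, $\pi_{1,m}=|I_{1,m}|/m$. $\omega:[-1,1]\to\mathbb{R}$ is admissible (non-negative, bounded, $\int_{[-1,1]}\omega(s)ds=1$), and $$K(t,x;\theta_0)=H(e^{\theta_0})\int_{[-1,1]}\frac{(ts)^x\cos\left(\frac{\pi x}2-tse^{\theta_0}\right)}{H^{(x)}(0)}\omega(s)ds,\qquad\hat\varphi_m(t,\mathbf z)=\frac1m\sum_{i=1}^m\{1-K(t,z_i;\theta_0)\}.$$ $\hat\varphi_m(t,\mathbf z)$ is the estimator of $\pi_{1,m}$ to which the claim refers. Uniform consistency class: a sequence of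 sets $\mathcal Q_m$ of pairs (parameter vector $\boldsymbol\theta$, $t$), $m=1,2,\dots$, is called a uniform consistency class for $\hat\varphi_m(t,\mathbf z)$ if $$\Pr\left\{\sup_{\boldsymbol\theta\in\mathcal Q_m}\left|\pi_{1,m}^{-1}\sup_{t\in\mathcal Q_m}\hat\varphi_m(t,\mathbf z)-1\right|\to0\right\}\to1.$$ The ''speed of convergence'' of $\hat\varphi_m(t_m,\mathbf z)$ is the sequence $t=t_m\to\infty$ employed; ''poly-log'' means it is of the order of a power of $\ln m$. *)

(* Defs.v *)
From HB Require Import structures.
From mathcomp Require Import all_boot all_order all_algebra.
From mathcomp Require Import all_classical all_reals all_analysis.

Set Implicit Arguments.
Unset Strict Implicit.
Unset Printing Implicit Defensive.

Import Order.TTheory GRing.Theory Num.Theory.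
Import numFieldNormedType.Exports.

Local Open Scope classical_set_scope.
Local Open Scope ring_scope.

Section NaturalExponentialFamily.
Variables (R : realType) (c : nat -> {posnum R}).

(* All measures involved are carried by the natural numbers, so the sample
   space is nat with its discrete sigma-algebra. *)
Definition nef_base : {measure set nat -> \bar R} :=
  mseries (fun k => mscale (c k)%:num%:nng (\d_k)) 0.

Definition nef_L (theta : R) : \bar R :=
  (\int[nef_base]_x (expR (x%:R * theta))%:E)%E.

(* The largest open subset of [set theta | L theta < +oo]. *)
Definition nef_Theta : set R :=
  interior [set theta | (nef_L theta < +oo)%E].

Definition nef_G (theta : R) (A : set nat) : \bar R :=
  (\int[nef_base]_(x in A) (expR (theta * x%:R - ln (fine (nef_L theta))))%:E)%E.

Definition nef_H (z : R) : R := limn (pseries (fun k => (c k)%:num) z).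

Definition poisson_family : Prop := forall k, (c k)%:num = (k`!%:R)^-1 :> R.

End NaturalExponentialFamily.

Section Estimator.
Variables (R : realType) (c : nat -> {posnum R}).
Variables (theta0 : R) (omega : R -> R).

Definition admissible : Prop :=
  [/\ measurable_fun (`[-1, 1] : set R) omega,
      (forall s, -1 <= s <= 1 -> 0 <= omega s),
      (exists M, forall s, -1 <= s <= 1 -> omega s <= M) &
      (\int[lebesgue_measure]_(s in `[(-1)%R, 1%R]) (omega s)%:E = 1)%E].

Definition kernel_K (t : R) (x : nat) : R :=
  nef_H c (expR theta0) *
  \int[lebesgue_measure]_(s in `[(-1)%R, 1%R])
     ((t * s) ^+ x * cos (pi * x%:R / 2 - t * s * expR theta0)
      / derive1n x (nef_H c) 0 * omega s).

Definition phi_hat m (t : R) (z : 'I_m -> nat) : R :=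
  m%:R^-1 * \sum_(i < m) (1 - kernel_K t (z i)).

Definition nonnulls m (theta : 'rV[R]_m) : {set 'I_m} :=
  [set i | theta ord0 i != theta0]%SET.

Definition pi1 m (theta : 'rV[R]_m) : R := #|nonnulls theta|%:R / m%:R.

Definition eta m (theta : 'rV[R]_m) : 'rV[R]_m := map_mx expR theta.

(* The minimum of |eta_0 - eta_i| over the non-null indices, +oo when there
   are none. *)
Definition min_gap m (theta : 'rV[R]_m) : \bar R :=
  \big[Order.min/+oo%E]_(i in nonnulls theta)
    (`|expR theta0 - eta theta ord0 i|)%:E.

End Estimator.

(* The product rule over the full index set contains the rule for every
   subfamily, by taking the remaining sets to be setT. *)
Definition mutually_independent (R : realType) d (T : measurableType d)
    (P : probability T R) m (z : 'I_m -> {mfun T >-> nat}) : Prop :=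
  forall A : 'I_m -> set nat,
    P (\bigcap_i z i @^-1` A i) = (\prod_(i < m) P (z i @^-1` A i))%E.

(* The law of the data depends on the unknown parameter vector: Pr m theta is
   the probability under which z_1, ..., z_m are independent with
   z_i ~ G_(theta_i).  Nothing is required when some theta_i is not in
   Theta. *)
Definition nef_experiment (R : realType) (c : nat -> {posnum R})
    (d : nat -> measure_display) (Omega : forall m, measurableType (d m))
    (Pr : forall m, 'rV[R]_m -> probability (Omega m) R)
    (z : forall m, 'I_m -> {mfun Omega m >-> nat}) : Prop :=
  forall m (theta : 'rV[R]_m), (forall i, nef_Theta c (theta ord0 i)) ->
    mutually_independent (Pr m theta) (z m) /\
    (forall i (A : set nat),
        distribution (Pr m theta) (z m i) A = nef_G c (theta ord0 i) A).

(* Pr {sup_theta |pi1^-1 sup_t phi_hat - 1| --> 0} --> 1 is convergence in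
   probability, uniformly over the parameters theta in Q_m.  The law of the
   data depends on theta, so the worst case over theta is taken over the
   probabilities Pr m theta.  The supremum over t is over the section of Q_m
   at theta. *)
Definition uniform_consistency_class (R : realType) (c : nat -> {posnum R})
    (theta0 : R) (omega : R -> R)
    (d : nat -> measure_display) (Omega : forall m, measurableType (d m))
    (Pr : forall m, 'rV[R]_m -> probability (Omega m) R)
    (z : forall m, 'I_m -> {mfun Omega m >-> nat})
    (Q : forall m, set ('rV[R]_m * R)) : Prop :=
  forall eps delta : R, 0 < eps -> 0 < delta ->
  \forall m \near \oo, forall theta : 'rV[R]_m,
    (exists t, Q m (theta, t)) ->
    ((1 - delta)%:E <=
     Pr m theta [set w |
       `| (pi1 theta0 theta)^-1%:E *
          ereal_sup [set (phi_hat c theta0 omega t (fun i => z m i w))%:E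
                    | t in [set t | Q m (theta, t)]] - 1 | <= eps%:E])%E.

(* Every t employed by Q_m is, uniformly, of the exact order of a positive
   power of ln m. *)
Definition polylog_speed (R : realType) (Q : forall m, set ('rV[R]_m * R)) :
    Prop :=
  exists a b B : R, [/\ 0 < a, 0 < b, 0 < B &
    \forall m \near \oo, forall (theta : 'rV[R]_m) (t : R), Q m (theta, t) ->
      b * ln m%:R `^ a <= t <= B * ln m%:R `^ a].

Section Classes.
Variables (R : realType) (c : nat -> {posnum R}) (theta0 : R).

(* A condition lim_m t * min_(i in I_(1,m)) |eta_0 - eta_i| = +oo constrains
   sequences of parameters and not a single Q_m.  In the classes below it is
   encoded by a lower bound u_m for t * min, where u_m --> +oo is arbitrary. *)

Definition Q_II_1 (rho gamma : R) (u : nat -> R) m : set ('rV[R]_m * R) :=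
  [set p : 'rV[R]_m * R | let: (theta, t) := p in
   [/\ (forall i, nef_Theta c (theta ord0 i)),
       `|theta| <= rho,
       m%:R `^ ((gamma - 1) / 2) <= pi1 theta0 theta,
       t = 2^-1 * `|eta theta| `^ (- 2^-1) * gamma * ln m%:R &
       ((u m)%:E <= t%:E * min_gap theta0 theta)%E]].

Definition Q_II_2 (rho gamma gamma' : R) (u : nat -> R) m :
    set ('rV[R]_m * R) :=
  [set p : 'rV[R]_m * R | let: (theta, t) := p in
   [/\ (forall i, nef_Theta c (theta ord0 i)),
       `|theta| <= rho,
       m%:R `^ ((gamma' - 1) / 2) <= pi1 theta0 theta,
       t = Num.sqrt (`|eta theta| `^ (- 2^-1) * gamma * ln m%:R) &
       ((u m)%:E <= t%:E * min_gap theta0 theta)%E]].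

End Classes.

(* Main.v *)
Require Import Defs.
From HB Require Import structures.
From mathcomp Require Import all_boot all_order all_algebra.
From mathcomp Require Import all_classical all_reals all_analysis.
From mathcomp Require Import measurable_realfun ring lra.

(** The estimator is unbiased up to an oscillating integral.  Expanding the
    kernel in powers of t s eta and summing the series
      sum_x a^x / x! cos (pi x / 2 - b) = cos (a - b)
    gives, for z distributed as G_theta with eta = exp theta,
      E K(t, z) = H(eta_0) / H(eta) * psi (t (eta - eta_0)),
      psi (y) = the integral of cos (y s) omega (s) over [-1, 1]
    (cvg_mean_kernel_K).  For theta = theta_0 the mean is exactly 1, so a null
    coordinate contributes nothing to the mean of phi_hat; on a non-null one
    |t (eta - eta_0)| is at least u_m, and the Riemann-Lebesgue lemma
    (riemann_lebesgue) makes the mean of K uniformly small.  Hence the mean of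
    phi_hat is pi_1 (1 + o(1)), uniformly over the class, and it remains to
    bound the fluctuations of phi_hat by o(pi_1).

    The fluctuations are handled by truncation (deviation_observable): the part
    of K supported by {0, ..., N - 1} is a simple function, to which Chebyshev's
    inequality applies with finite sums only, and the rest is bounded in the
    mean by Markov's inequality.  So each class reduces to finding a level N, a
    bound V of the truncated second moment and a bound B of the tail first
    moment with V / (m pi_1^2) and B / pi_1 tending to 0
    (uniform_consistency_of_moments).

    In the first class the second moment of K is at most of the order of
    sum_x y^(2 x) / (x!)^2 / (2 x + 1) with y = t sqrt eta, where 1 / (2 x + 1)
    comes from the moments of the bounded density omega.  This is at most
    exp (2 y) / y (sum_bessel_le), and 2 y <= gamma ln m.  The factor 1 / y is
    essential, because m pi_1^2 is only bounded below by m^gamma.  The level N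
    is taken so large that the tail is negligible.

    In the Poisson class the full second moment is only bounded by exp (t^2 eta),
    with t^2 eta at most a constant D times ln m, and D may well exceed 1.  But
    this exponential comes from values of z of the order of ln m, which are
    too improbable to matter: for a small alpha and N = alpha ln m, Chernoff
    bounds give, up to constants, a truncated second moment m^(gamma' / 2)
    (exp_head_le) and, as t eta is only of the order of sqrt (ln m), a tail first
    moment m^(gamma' / 4 - 1 / 2) (exp_tail_le). *)

Set Implicit Arguments.
Unset Strict Implicit.
Unset Printing Implicit Defensive.

Import Order.TTheory GRing.Theory Num.Theory.
Import numFieldNormedType.Exports.

Local Open Scope classical_set_scope.
Local Open Scope ring_scope.

(** * Derivatives of a power series at its centre *)

Section PowerSeries.
Variable R : realType.
Implicit Types (a : nat -> R) (r x : R).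

Lemma lim_pseries0 a : limn (pseries a 0) = a 0%N.
Proof.
apply: (@cvg_lim R) => //; rewrite -cvg_shiftS /=.
rewrite [X in X @ _ --> _](_ : _ = cst (a 0%N)); first exact: cvg_cst.
apply/funext => n; rewrite /pseries /series /= big_nat_recl//= expr0 mulr1.
by rewrite big1 ?addr0// => i _; rewrite expr0n mulr0.
Qed.

(** Since (n + 1) x^n (y - x) <= y^(n + 1), the differentiated series at x is
    dominated by the series itself at a point y of convergence beyond x. *)
Lemma is_cvg_pseries_diffs a r : (forall n, 0 <= a n) ->
  (forall x, 0 <= x < r -> cvgn (pseries a x)) ->
  forall x, 0 <= x < r -> cvgn (pseries (pseries_diffs a) x).
Proof.
move=> a0 cva x /andP[x0 xr].
pose y := (x + r) / 2; have xy : x < y by rewrite /y; lra.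
have yr : 0 <= y < r by rewrite /y; lra.
have y0 : 0 < y by apply: le_lt_trans xy.
apply: (@series_le_cvg _ _ (fun n => (y - x)^-1 * (a n.+1 * y ^+ n.+1))).
- by move=> n; rewrite /pseries_diffs !mulr_ge0// exprn_ge0.
- move=> n; rewrite !mulr_ge0// ?exprn_ge0 ?(ltW y0)// invr_ge0 subr_ge0.
  exact: ltW.
- move=> n; rewrite /pseries_diffs.
  rewrite ler_pdivlMl ?subr_gt0//.
  have -> : (y - x) * (n.+1%:R * a n.+1 * x ^+ n) =
            a n.+1 * ((y - x) * (n.+1%:R * x ^+ n)) by ring.
  apply: ler_wpM2l => //.
  have : n.+1%:R * x ^+ n <= \sum_(i < n.+1) y ^+ (n - i) * x ^+ i.
    rewrite mulr_natl -[X in x ^+ n *+ X]card_ord -sumr_const; apply: ler_sum => i _.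
    have -> : x ^+ n = x ^+ (n - i) * x ^+ i by rewrite -exprD subnK// -ltnS.
    rewrite ler_wpM2r ?exprn_ge0// lerXn2r ?nnegrE ?(ltW y0)//; exact: ltW.
  move=> h; apply: le_trans (_ : _ <= y ^+ n.+1 - x ^+ n.+1) _.
    by rewrite subrXX ler_wpM2l// subr_ge0 ltW.
  by rewrite gerBl exprn_ge0.
- apply: is_cvg_seriesZ.
  have := cva _ yr; rewrite /pseries => /cvg_ex[l hl].
  apply/cvg_ex; exists (l - a 0%N).
  have -> : series (fun n => a n.+1 * y ^+ n.+1) =
     (fun n => series (fun i => a i * y ^+ i) n.+1 - a 0%N).
    apply/funext => n; rewrite /series/= big_nat_recl// expr0 mulr1.
    by rewrite addrAC subrr add0r.
  apply: cvgB; last exact: cvg_cst.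
  by move: hl; rewrite -cvg_shiftS.
Qed.

Lemma derive1n_pseries a r : (forall n, 0 <= a n) ->
  (forall x, 0 <= x < r -> cvgn (pseries a x)) ->
  forall n x, `|x| < r ->
    derive1n n (fun y => limn (pseries a y)) x =
    limn (pseries (iter n (@pseries_diffs R) a) x).
Proof.
move=> a0 cva n.
have dge0 k : forall i, 0 <= iter k (@pseries_diffs R) a i.
  by elim: k => //= k ih i; rewrite /pseries_diffs mulr_ge0.
have dcvg k : forall x, 0 <= x < r -> cvgn (pseries (iter k (@pseries_diffs R) a) x).
  by elim: k => //= k ih; apply: is_cvg_pseries_diffs.
elim: n => // n ih x xr.
rewrite derive1nS derive1E.
transitivity ('D_1 (fun y => limn (pseries (iter n (@pseries_diffs R) a) y)) x).
  apply: near_eq_derive.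
  have : nbhs x (ball x (r - `|x|)) by apply: nbhsx_ballx; rewrite subr_gt0.
  apply: filterS => y; rewrite /ball/= => hy; apply: ih.
  have := ler_distD y x 0; rewrite !subr0 => h.
  have := ler_distD x y 0; rewrite !subr0 distrC => h2.
  by apply: le_lt_trans h2 _; move: hy; lra.
pose K := (`|x| + r) / 2.
have K0 : 0 <= K < r by rewrite /K; have := normr_ge0 x; move: xr; lra.
have := @pseries_snd_diffs R (iter n (@pseries_diffs R) a) K x (dcvg _ _ K0)
   (dcvg n.+1 _ K0) (dcvg n.+2 _ K0).
move=> H; apply: (@derive_val _ _ _ _ _ _ _ (H _)).
by rewrite (ger0_norm (andP K0).1) /K; lra.
Qed.

Lemma derive1n_pseries0 a r : 0 < r -> (forall n, 0 <= a n) ->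
  (forall x, 0 <= x < r -> cvgn (pseries a x)) ->
  forall n, derive1n n (fun y => limn (pseries a y)) 0 = a n * n`!%:R.
Proof.
move=> r0 a0 cva n; rewrite (derive1n_pseries a0 cva) ?normr0// lim_pseries0.
suff H k : iter n (@pseries_diffs R) a k = a (n + k)%N * ((n + k)`!%:R / k`!%:R).
  by rewrite H addn0 fact0 divr1.
elim: n k => [|n ih] k; first by rewrite add0n divff ?mulr1// pnatr_eq0 -lt0n fact_gt0.
rewrite iterS /pseries_diffs ih addSnnS mulrCA; congr (_ * _).
rewrite mulrCA; congr (_ * _); rewrite factS natrM invfM mulrA divff ?mul1r//.
Qed.

End PowerSeries.

(** * The natural exponential family *)

Section NEF.
Variables (R : realType) (c : nat -> {posnum R}).
Implicit Types (theta : R) (k : nat).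

Lemma integral_nef_base (f : nat -> \bar R) (A : set nat) :
  (forall k, (0 <= f k)%E) ->
  (\int[nef_base c]_(x in A) f x =
   \sum_(0 <= k <oo) ((c k)%:num%:E * ((\d_k A : \bar R) * f k)))%E.
Proof.
move=> f0; have mf : measurable_fun A (f : nat -> \bar R) by [].
rewrite /nef_base ge0_integral_measure_series//.
apply: eq_eseriesr => k _.
by rewrite ge0_integral_mscale// integral_dirac.
Qed.

Lemma nef_LE theta :
  nef_L c theta = (\sum_(0 <= k <oo) ((c k)%:num * expR theta ^+ k)%:E)%E.
Proof.
rewrite /nef_L integral_nef_base; last by move=> k; rewrite lee_fin expR_ge0.
by apply: eq_eseriesr => k _; rewrite diracT mul1e -EFinM expRM_natl.
Qed.

Section Converging.
Variable theta : R.
Hypothesis L_fin : (nef_L c theta < +oo)%E.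

Lemma is_cvg_nef_H : cvgn (pseries (fun k => (c k)%:num) (expR theta)).
Proof.
have := L_fin; rewrite nef_LE => h.
apply: nondecreasing_is_cvgn.
  apply/nondecreasing_seqP => n; rewrite /pseries seriesSr lerDl.
  by rewrite mulr_ge0// exprn_ge0// expR_ge0.
exists (fine (nef_L c theta)) => _ [n _ <-].
rewrite -lee_fin fineK; last first.
  rewrite ge0_fin_numE// nef_LE; apply: nneseries_ge0 => k _ _.
  by rewrite lee_fin mulr_ge0// exprn_ge0// expR_ge0.
rewrite nef_LE /pseries /series/= -sumEFin.
apply: nneseries_lim_ge => k _ _.
by rewrite lee_fin mulr_ge0// exprn_ge0// expR_ge0.
Qed.

Lemma nef_HE : nef_L c theta = (nef_H c (expR theta))%:E.
Proof.
rewrite nef_LE /nef_H -EFin_lim; last exact: is_cvg_nef_H.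
congr (limn _); apply/funext => n /=.
by rewrite /pseries/series/= -sumEFin.
Qed.

(** The bound c 0 does not depend on theta, which makes the bounds below uniform
    in the parameter. *)
Lemma nef_H_ge : (c 0%N)%:num <= nef_H c (expR theta).
Proof.
rewrite /nef_H; apply: limr_ge; first exact: is_cvg_nef_H.
near=> n; rewrite /pseries/series/=.
have n0 : (0 < n)%N by near: n; exact: nbhs_infty_gt.
rewrite -(prednK n0) big_nat_recl//= expr0 mulr1 lerDl.
by apply: sumr_ge0 => k _; rewrite mulr_ge0// exprn_ge0// expR_ge0.
Unshelve. all: by end_near. Qed.

Lemma nef_H_gt0 : 0 < nef_H c (expR theta).
Proof. exact: lt_le_trans nef_H_ge. Qed.

Lemma nef_G_set1 k : nef_G c theta [set k] =
  ((c k)%:num * expR theta ^+ k / nef_H c (expR theta))%:E.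
Proof.
rewrite /nef_G integral_nef_base; last by move=> j; rewrite lee_fin expR_ge0.
rewrite (nneseries_split 0 k.+1)/=; last first.
  by move=> j _; do 2 apply: mule_ge0 => //; rewrite lee_fin ?expR_ge0.
rewrite eseries0 ?adde0; last first.
  move=> j; rewrite add0n => kj _.
  rewrite diracE memNset ?mul0e ?mule0//= => jk.
  by move: kj; rewrite jk ltnn.
rewrite add0n big_nat_recr//= big_nat big1 ?add0r ?add0e; last first.
  move=> j /= jk; rewrite diracE memNset ?mul0e ?mule0//= => ej.
  by move: jk; rewrite ej ltnn.
rewrite diracE mem_set//= mul1e -EFinM nef_HE /= expRB lnK ?posrE ?nef_H_gt0//.
by rewrite expRM_natr mulrA.
Qed.

Lemma derive1n_nef_H k : derive1n k (nef_H c) 0 = (c k)%:num * k`!%:R.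
Proof.
apply: (@derive1n_pseries0 R (fun k => (c k)%:num) (expR theta)).
- exact: expR_gt0.
- by [].
- move=> x /andP[x0 xt]; apply: is_cvg_pseries_inside is_cvg_nef_H _.
  by rewrite !ger0_norm// expR_ge0.
Qed.

End Converging.

Lemma nef_Theta_L theta : nef_Theta c theta -> (nef_L c theta < +oo)%E.
Proof. exact: (@interior_subset _ _ theta). Qed.

End NEF.

(** * Deviations of sums of independent integer-valued observables *)

Section RintegralSums.
Context d (T : measurableType d) (R : realType) (mu : {measure set T -> \bar R}).
Variables (D : set T) (mD : measurable D).

Lemma integrable_Rsum (I : Type) (s : seq I) (h : I -> T -> R) :
  (forall i, mu.-integrable D (EFin \o h i)) ->
  mu.-integrable D (EFin \o (fun x => \sum_(i <- s) h i x)).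
Proof.
move=> ih; have -> : EFin \o (fun x => \sum_(i <- s) h i x) =
    (fun x => \sum_(i <- s) (h i x)%:E)%E.
  by apply/funext => x /=; rewrite sumEFin.
by apply: (@integrable_sum _ _ _ mu D mD I s xpredT (fun i x => (h i x)%:E)) => i _; exact: ih.
Qed.

Lemma integrable_RZl (k : R) (f : T -> R) : mu.-integrable D (EFin \o f) ->
  mu.-integrable D (EFin \o (fun x => k * f x)).
Proof. by move=> /(@integrableZl _ _ _ mu D mD k). Qed.

Lemma integrable_RB (f g : T -> R) : mu.-integrable D (EFin \o f) ->
  mu.-integrable D (EFin \o g) -> mu.-integrable D (EFin \o (fun x => f x - g x)).
Proof. by move=> fi gi; have := integrableB mD fi gi. Qed.

Lemma Rintegral_sum (I : Type) (s : seq I) (h : I -> T -> R) :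
  (forall i, mu.-integrable D (EFin \o h i)) ->
  (\int[mu]_(x in D) (\sum_(i <- s) h i x) =
   \sum_(i <- s) \int[mu]_(x in D) h i x)%R.
Proof.
move=> ih; elim: s => [|i s IHs].
  under eq_Rintegral do rewrite big_nil.
  by rewrite big_nil Rintegral_cst// mul0r.
under eq_Rintegral do rewrite big_cons.
by rewrite big_cons RintegralD// ?IHs//; exact: integrable_Rsum.
Qed.

End RintegralSums.

Section Deviation.
Context d (T : measurableType d) (R : realType) (P : probability T R).
Variables (m : nat) (z : 'I_m -> {mfun T >-> nat}).
Variable p : 'I_m -> nat -> R.
Hypothesis Pz : forall i k, P (z i @^-1` [set k]) = (p i k)%:E.
Hypothesis Pzz : forall i j a b, i != j ->
  P (z i @^-1` [set a] `&` z j @^-1` [set b]) = (p i a * p j b)%:E.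

Let mz i (A : set nat) : measurable (z i @^-1` A).
Proof. by rewrite -[X in measurable X]setTI; exact: measurable_funP. Qed.

Lemma marginal_ge0 i k : 0 <= p i k.
Proof. by rewrite -lee_fin -Pz. Qed.

Lemma integrable_indic_prob (A : set T) : measurable A ->
  P.-integrable setT (EFin \o (\1_A : T -> R)).
Proof. by move=> mA; apply: integrable_indic => //; rewrite setTI; exact: fin_num_fun_lty. Qed.

Lemma Rintegral_indic_prob (A : set T) : measurable A ->
  (\int[P]_w (\1_A w : R))%R = fine (P A).
Proof. by move=> mA; rewrite /Rintegral integral_indic// setIT. Qed.

Lemma Rintegral_prob_cst (k : R) : (\int[P]_w k)%R = k.
Proof.
rewrite Rintegral_cst//.
by have -> : (P : {measure set T -> \bar R}) setT = 1%E := probability_setT P; rewrite mulr1.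
Qed.

Section FiniteSupport.
Variables (N : nat) (f : nat -> R).
Hypothesis f0 : forall k, (N <= k)%N -> f k = 0.

(** A finite-support function of z is a finite combination of indicators, so
    independence is only used for events. *)
Lemma finite_support_indic i w :
  f (z i w) = \sum_(0 <= a < N) f a * \1_(z i @^-1` [set a]) w.
Proof.
have [lt|ge] := ltnP (z i w) N.
  rewrite (bigD1_seq (z i w))/= ?mem_index_iota ?iota_uniq//.
  rewrite indicE mem_set// mulr1 big1 ?addr0// => a /eqP na.
  by rewrite indicE memNset ?mulr0//= => e; exact: na.
rewrite f0// big_nat big1// => a /= aN.
rewrite indicE memNset ?mulr0//= => e; move: ge; rewrite e leqNgt.
by rewrite aN.
Qed.

Lemma integrable_finite_support i : P.-integrable setT (EFin \o (fun w => f (z i w))).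
Proof.
under [X in EFin \o X]eq_fun do rewrite finite_support_indic.
apply: integrable_Rsum => // a.
by apply: integrable_RZl => //; exact: integrable_indic_prob.
Qed.

Lemma Rintegral_finite_support i :
  (\int[P]_w f (z i w))%R = \sum_(0 <= a < N) p i a * f a.
Proof.
under eq_Rintegral do rewrite finite_support_indic.
rewrite Rintegral_sum//; last first.
  by move=> a; apply: integrable_RZl => //; exact: integrable_indic_prob.
apply: eq_bigr => a _; rewrite RintegralZl//; last exact: integrable_indic_prob.
by rewrite Rintegral_indic_prob// Pz mulrC.
Qed.

End FiniteSupport.

Lemma Rintegral_finite_supportM N f i j : (forall k, (N <= k)%N -> f k = 0) ->
  i != j ->
  P.-integrable setT (EFin \o (fun w => f (z i w) * f (z j w))) /\
  (\int[P]_w (f (z i w) * f (z j w)))%R =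
  (\sum_(0 <= a < N) p i a * f a) * (\sum_(0 <= a < N) p j a * f a).
Proof.
move=> f0 ij.
have E w : f (z i w) * f (z j w) = \sum_(0 <= a < N) \sum_(0 <= b < N)
    (f a * f b) * \1_(z i @^-1` [set a] `&` z j @^-1` [set b]) w.
  rewrite !(finite_support_indic f0) mulr_suml; apply: eq_bigr => a _.
  by rewrite mulr_sumr; apply: eq_bigr => b _; rewrite indicI/= mulrACA.
have iI a b : P.-integrable setT (EFin \o (fun w => (f a * f b) *
    \1_(z i @^-1` [set a] `&` z j @^-1` [set b]) w)).
  by apply: integrable_RZl => //; apply: integrable_indic_prob; exact: measurableI.
split.
  under [X in EFin \o X]eq_fun do rewrite E.
  by apply: integrable_Rsum => // a; apply: integrable_Rsum => // b.
under eq_Rintegral do rewrite E.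
rewrite Rintegral_sum//; last by move=> a; apply: integrable_Rsum => // b.
rewrite mulr_suml; apply: eq_bigr => a _.
rewrite Rintegral_sum// mulr_sumr; apply: eq_bigr => b _.
rewrite RintegralZl//; last by apply: integrable_indic_prob; exact: measurableI.
rewrite Rintegral_indic_prob; last exact: measurableI.
by rewrite Pzz//=; ring.
Qed.

(** Pairwise independence cancels the cross terms of the second moment, up to the
    means. *)
Lemma chebyshev_finite_support N f V a : (forall k, (N <= k)%N -> f k = 0) ->
  (forall i, \sum_(0 <= k < N) p i k * f k ^+ 2 <= V) -> 0 < a ->
  (P [set w | (a <= `|\sum_(i < m) (f (z i w) -
       \sum_(0 <= k < N) p i k * f k)|)%R] <= (m%:R * V / a ^+ 2)%:E)%E.
Proof.
move=> f0 hV a0.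
pose mu i := \sum_(0 <= k < N) p i k * f k.
pose S w := \sum_(i < m) (f (z i w) - mu i).
have ifi := integrable_finite_support f0.
have Ef i : (\int[P]_w (f (z i w)))%R = mu i by rewrite (Rintegral_finite_support f0).
have ifc i : P.-integrable setT (EFin \o (fun w => f (z i w) - mu i)).
  apply: integrable_RB => //.
  exact: finite_measure_integrable_cst.
have f20 k : (N <= k)%N -> (fun k => f k ^+ 2) k = 0 by move=> /f0 ->; rewrite expr0n.
have icc i j : P.-integrable setT (EFin \o (fun w => f (z i w) * f (z j w))) /\
    (\int[P]_w (f (z i w) * f (z j w)))%R = mu i * mu j +
      (if i == j then \sum_(0 <= k < N) p i k * f k ^+ 2 - mu i ^+ 2 else 0).
  have [<-|ij] := eqVneq i j.
    rewrite -(Rintegral_finite_support f20); split.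
      exact: (integrable_finite_support f20).
    by rewrite -expr2 addrC subrK; apply: eq_Rintegral => w _; rewrite expr2.
  by rewrite addr0; exact: Rintegral_finite_supportM.
have ES w : S w ^+ 2 = \sum_(i < m) \sum_(j < m)
   (f (z i w) * f (z j w) - mu i * f (z j w) - mu j * (f (z i w) - mu i)).
  rewrite expr2 /S mulr_suml; apply: eq_bigr => i _.
  by rewrite mulr_sumr; apply: eq_bigr => j _; ring.
have i1 i j : P.-integrable setT (EFin \o (fun w => mu i * f (z j w))).
  exact: integrable_RZl.
have i2 i j : P.-integrable setT (EFin \o (fun w => mu i * (f (z j w) - mu j))).
  exact: integrable_RZl.
have i3 i j : P.-integrable setT (EFin \o (fun w => f (z i w) * f (z j w) - mu i * f (z j w))).
  by apply: integrable_RB => //; have [] := icc i j.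
have i4 i j : P.-integrable setT (EFin \o (fun w => f (z i w) * f (z j w) - mu i * f (z j w)
    - mu j * (f (z i w) - mu i))).
  by apply: integrable_RB => //; exact: i2.
have iS : P.-integrable setT (EFin \o (fun w => S w ^+ 2)).
  under [X in EFin \o X]eq_fun do rewrite ES.
  by apply: integrable_Rsum => // i; apply: integrable_Rsum => // j.
have mS : measurable_fun setT S.
  apply: measurable_sum => i.
  by have /measurable_int/measurable_EFinP := ifc i.
have mE : measurable [set w | a <= `|S w|].
  rewrite -[X in measurable X]setTI.
  by apply: measurable_fun_le => //; exact: measurableT_comp.
have ES2 : (\int[P]_w (S w ^+ 2))%R =
    \sum_(i < m) (\sum_(0 <= k < N) p i k * f k ^+ 2 - mu i ^+ 2).
  under eq_Rintegral do rewrite ES.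
  rewrite Rintegral_sum//; last by move=> i; apply: integrable_Rsum => // j.
  apply: eq_bigr => i _; rewrite Rintegral_sum//.
  transitivity (\sum_(j < m)
      (if i == j then \sum_(0 <= k < N) p i k * f k ^+ 2 - mu i ^+ 2 else 0)).
    apply: eq_bigr => j _; have [icij Ecij] := icc i j.
    rewrite (RintegralB measurableT (i3 i j) (i2 j i)).
    rewrite (RintegralB measurableT icij (i1 i j)) Ecij.
    rewrite !RintegralZl// RintegralB//; last exact: finite_measure_integrable_cst.
    rewrite !Ef Rintegral_prob_cst subrr mulr0 subr0.
    by rewrite addrAC subrr add0r.
  by rewrite -big_mkcond/= (big_pred1 i)// => j; rewrite eq_sym.
have : fine (P [set w | a <= `|S w|]) * a ^+ 2 <= m%:R * V.
  rewrite mulrC -Rintegral_indic_prob// -RintegralZl//; last exact: integrable_indic_prob.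
  apply: (@le_trans _ _ (\int[P]_w (S w ^+ 2))%R).
    apply: le_Rintegral => //.
      by apply: integrable_RZl => //; exact: integrable_indic_prob.
    move=> w _; rewrite indicE; have [|_] := boolP (w \in _); last by rewrite mulr0 sqr_ge0.
    rewrite inE mulr1/= => aS; rewrite -[leRHS]real_normK ?num_real//.
    by rewrite lerXn2r ?nnegrE// ltW.
  rewrite ES2 -[m in m%:R]card_ord mulr_natl -sumr_const; apply: ler_sum => i _.
  by rewrite (le_trans _ (hV i))// gerBl sqr_ge0.
rewrite -ler_pdivlMr ?exprn_gt0// => h.
by rewrite -(fineK (fin_num_measure P _ mE)) lee_fin.
Qed.

Lemma integral_observable (g : nat -> R) i : (forall k, 0 <= g k) ->
  (\int[P]_w (g (z i w))%:E = \sum_(0 <= k <oo) (p i k * g k)%:E)%E.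
Proof.
move=> g0.
have E w : ((g (z i w))%:E =
    \sum_(0 <= k <oo) (g k * \1_(z i @^-1` [set k]) w)%:E)%E.
  rewrite (nneseries_split 0 (z i w).+1)/=; last first.
    by move=> k _; rewrite lee_fin mulr_ge0.
  rewrite eseries0 ?adde0; last first.
    move=> k; rewrite add0n => kw _.
    rewrite indicE memNset ?mulr0//= => e.
    by move: kw; rewrite e ltnn.
  rewrite add0n big_nat_recr//= big_nat big1 ?add0e; last first.
    move=> k /= kw; rewrite indicE memNset ?mulr0//= => e.
    by move: kw; rewrite e ltnn.
  by rewrite indicE mem_set// mulr1.
under eq_integral do rewrite E.
rewrite integral_nneseries//; last 2 first.
- move=> k; apply/measurable_EFinP; apply: measurable_funM => //.
- by move=> k w _; rewrite lee_fin mulr_ge0.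
apply: eq_eseriesr => k _.
under eq_integral do rewrite EFinM.
rewrite ge0_integralZl_EFin//; last first.
  by apply/measurable_EFinP; exact: measurable_indic.
have -> : (\int[P]_w (\1_(z i @^-1` [set k]) w)%:E = P (z i @^-1` [set k]))%E.
  by rewrite integral_indic// setIT.
by rewrite Pz -EFinM mulrC.
Qed.

(** With a split of f at N, the sum deviates by a only if the head deviates by
    a / 3 (Chebyshev), the tail exceeds a / 3 (Markov) or the tails of the means,
    at most m B, exceed a / 3; in the last case the bound is at least 1. *)
Lemma deviation_observable (N : nat) (f : nat -> R) (e : 'I_m -> R) (V B a : R) :
  (forall i, \sum_(0 <= k < N) p i k * f k ^+ 2 <= V) ->
  (forall i n, \sum_(N <= k < n) p i k * `|f k| <= B) ->
  (forall i, series (fun k => p i k * f k) n @[n --> \oo] --> e i) ->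
  0 < a ->
  (P [set w | (a <= `|\sum_(i < m) (f (z i w) - e i)|)%R] <=
   (9 * (m%:R * V) / a ^+ 2 + 3 * (m%:R * B) / a)%:E)%E.
Proof.
move=> hV hB he a0.
have B0 : (0 < m)%N -> 0 <= B.
  by move=> m0; have := hB (Ordinal m0) 0%N; rewrite big_geq.
have mB0 : 0 <= m%:R * B.
  by have [->|/B0 ?] := posnP m; [rewrite mul0r | rewrite mulr_ge0].
have V0 : 0 <= m%:R * V.
  have [->|m0] := posnP m; first by rewrite mul0r.
  rewrite mulr_ge0//; apply: le_trans (hV (Ordinal m0)).
  by apply: sumr_ge0 => k _; rewrite mulr_ge0 ?marginal_ge0 ?sqr_ge0.
pose f1 k : R := if (k < N)%N then f k else 0.
pose f2 k : R := if (k < N)%N then 0 else `|f k|.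
pose mu i := \sum_(0 <= k < N) p i k * f1 k.
have f10 k : (N <= k)%N -> f1 k = 0 by rewrite /f1 leqNgt => /negbTE ->.
have f20 k : 0 <= f2 k by rewrite /f2; case: ifP.
have muE i : mu i = \sum_(0 <= k < N) p i k * f k.
  by rewrite /mu !big_nat; apply: eq_bigr => k /= kN; rewrite /f1 kN.
have emu i : `|e i - mu i| <= B.
  have h : (fun n => `|series (fun k => p i k * f k) n - mu i|) n @[n --> \oo]
      --> `|e i - mu i|.
    by apply: cvg_norm; apply: cvgB; [exact: he|exact: cvg_cst].
  apply: (cvgr_to_le h); near=> n.
  have Nn : (N <= n)%N by near: n; exact: nbhs_infty_ge.
  rewrite muE /series/= (big_cat_nat (leq0n N) Nn)//= addrAC subrr add0r.
  apply: le_trans (hB i n); apply: le_trans (ler_norm_sum _ _ _) _.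
  by apply: ler_sum => k _; rewrite normrM ger0_norm// marginal_ge0.
have mf (g : nat -> R) i : measurable_fun setT (fun w => g (z i w)).
  exact: (@measurableT_comp _ _ _ _ _ _ g).
pose S w := \sum_(i < m) (f1 (z i w) - mu i).
pose Y w := \sum_(i < m) f2 (z i w).
have mS : measurable_fun setT S.
  by apply: measurable_sum => i; apply: measurable_funB => //; exact: mf.
have mY : measurable_fun setT Y by apply: measurable_sum => i; exact: mf.
have mle (g : T -> R) b : measurable_fun setT g -> measurable [set w | b <= g w].
  move=> mg; rewrite -[X in measurable X]setTI.
  exact: measurable_fun_le.
have hS : (P [set w | (a / 3 <= `|S w|)%R] <= (9 * (m%:R * V) / a ^+ 2)%:E)%E.
  have -> : 9 * (m%:R * V) / a ^+ 2 = m%:R * V / (a / 3) ^+ 2.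
    by field; rewrite gt_eqF.
  apply: chebyshev_finite_support => //; last by rewrite divr_gt0.
  move=> i; apply: le_trans (hV i); rewrite le_eqVlt; apply/orP; left; apply/eqP.
  by rewrite !big_nat; apply: eq_bigr => k /= kN; rewrite /f1 kN.
have hY : (P [set w | (a / 3 <= Y w)%R] <= (3 * (m%:R * B) / a)%:E)%E.
  have EY i : (\int[P]_w (f2 (z i w))%:E <= B%:E)%E.
    rewrite integral_observable//.
    apply: lime_le.
      apply: is_cvg_nneseries => k _ _; rewrite lee_fin mulr_ge0 ?marginal_ge0//.
    near=> n; have Nn : (N <= n)%N by near: n; exact: nbhs_infty_ge.
    rewrite sumEFin lee_fin (big_cat_nat (leq0n N) Nn)//= big_nat big1 ?add0r; last first.
      by move=> k /= kN; rewrite /f2 kN mulr0.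
    apply: le_trans (hB i n); rewrite big_nat [leRHS]big_nat.
    by apply: ler_sum => k /andP[kN _]; rewrite /f2 ltnNge kN.
  have EYs : (\int[P]_w (Y w)%:E <= (m%:R * B)%:E)%E.
    under eq_integral do rewrite /Y -sumEFin.
    rewrite ge0_integral_sum//; last 2 first.
    - by move=> i; apply/measurable_EFinP; exact: mf.
    - by move=> i w _; rewrite lee_fin.
    apply: (@le_trans _ _ (\sum_(i < m) B%:E)%E).
      by apply: lee_sum => i _; exact: EY.
    by rewrite sumEFin lee_fin sumr_const card_ord mulr_natl.
  have Y0 w : 0 <= Y w by apply: sumr_ge0.
  have : ((a / 3)%:E * P [set w | (a / 3 <= Y w)%R] <= (m%:R * B)%:E)%E.
    apply: le_trans EYs.
    have := @le_integral_comp_abse _ _ _ P setT measurableT (EFin \o Y) (a / 3) id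
    (@measurable_id _ _ _) (fun _ => id) (fun _ _ _ _ => id) _ _.
    rewrite setTI.
    under eq_integral do rewrite /= ger0_norm//.
    under eq_set do rewrite /= ger0_norm// lee_fin.
    apply; last by rewrite divr_gt0.
    exact/measurable_EFinP.
  rewrite -(fineK (fin_num_measure P _ (mle _ _ mY))) -EFinM !lee_fin.
  have -> : 3 * (m%:R * B) / a = m%:R * B / (a / 3) by field; rewrite gt_eqF.
  by rewrite mulrC -ler_pdivlMr ?divr_gt0.
have mD : measurable [set w | (a <= `|\sum_(i < m) (f (z i w) - e i)|)%R].
  apply: mle; apply: measurableT_comp => //; apply: measurable_sum => i.
  by apply: measurable_funB => //; exact: mf.
have mS' : measurable [set w | (a / 3 <= `|S w|)%R].
  by apply: mle; exact: measurableT_comp.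
have [aB|aB] := leP (a / 3) (m%:R * B).
  apply: (@le_trans _ _ 1%E); first exact: (probability_le1 P mD).
  rewrite lee_fin; apply: (@le_trans _ _ (3 * (m%:R * B) / a)).
    by rewrite ler_pdivlMr// mul1r; move: aB; lra.
  by rewrite lerDr divr_ge0 ?sqr_ge0// mulr_ge0.
rewrite EFinD; apply: le_trans (leeD hS hY).
apply: le_trans (measureU2 _ mS' (mle _ _ mY)).
apply: le_measure; rewrite ?inE//; first by apply: measurableU => //; exact: mle.
move=> w /= aw.
have [h1|h1] := leP (a / 3) `|S w|; first by left.
have [h2|h2] := leP (a / 3) (Y w); first by right.
exfalso; move: aw; apply/negP; rewrite -ltNge.
have -> : \sum_(i < m) (f (z i w) - e i) = S w +
    \sum_(i < m) (f (z i w) - f1 (z i w)) - \sum_(i < m) (e i - mu i).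
  by rewrite /S -big_split -sumrB/=; apply: eq_bigr => i _; ring.
have h3 : `|\sum_(i < m) (f (z i w) - f1 (z i w))| <= Y w.
  apply: le_trans (ler_norm_sum _ _ _) _; apply: ler_sum => i _.
  by rewrite /f1 /f2; case: ifP => _; rewrite ?subrr ?normr0 ?subr0.
have h4 : `|\sum_(i < m) (e i - mu i)| <= m%:R * B.
  apply: le_trans (ler_norm_sum _ _ _) _.
  rewrite -[m in m%:R]card_ord mulr_natl -sumr_const.
  by apply: ler_sum => i _.
have := ler_normB (S w + \sum_(i < m) (f (z i w) - f1 (z i w))) (\sum_(i < m) (e i - mu i)).
have := ler_normD (S w) (\sum_(i < m) (f (z i w) - f1 (z i w))).
lra.
Unshelve. all: by end_near. Qed.
End Deviation.

(** * Integrals of continuous functions over a segment *)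

Section ContinuousFunctions.
Variable R : realType.
Implicit Types f g F : R -> R.

Lemma continuous_cosZB (a b : R) : continuous (fun s : R => cos (a * s - b)).
Proof.
move=> s; apply: (@continuous_comp _ _ _ (fun s : R => a * s - b) cos).
  by apply: cvgB; [exact: mulrl_continuous|exact: cvg_cst].
exact: continuous_cos.
Qed.

Lemma continuous_fM f g : continuous f -> continuous g ->
  continuous (fun s => f s * g s).
Proof. by move=> cf cg s; apply: cvgM; [exact: cf|exact: cg]. Qed.

Lemma continuous_fB f g : continuous f -> continuous g ->
  continuous (fun s => f s - g s).
Proof. by move=> cf cg s; apply: cvgB; [exact: cf|exact: cg]. Qed.

Lemma continuous_fZ k f : continuous f -> continuous (fun s => k * f s).
Proof. by move=> cf; apply: continuous_fM => // s; exact: cvg_cst. Qed.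

Lemma continuous_fX n : continuous (fun s : R => s ^+ n).
Proof. exact: exprn_continuous. Qed.

Lemma continuous_fsum (I : Type) (r : seq I) (h : I -> R -> R) :
  (forall i, continuous (h i)) -> continuous (fun s => \sum_(i <- r) h i s).
Proof.
move=> ch; elim: r => [|i r ih].
  under [X in continuous X]eq_fun do rewrite big_nil.
  by move=> s; exact: cvg_cst.
under [X in continuous X]eq_fun do rewrite big_cons.
by move=> s; apply: cvgD; [exact: ch|exact: ih].
Qed.

Lemma Rintegral_FTC f F (a b : R) : a < b -> continuous f ->
  (forall x : R, is_derive x 1 F (f x)) ->
  (\int[lebesgue_measure]_(x in `[a, b]) f x)%R = F b - F a.
Proof.
move=> ab cf dF; rewrite /Rintegral (@continuous_FTC2 _ f F a b)//.
- exact: continuous_subspaceT.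
- have cF : continuous F.
    by move=> x; apply/differentiable_continuous/derivable1_diffP; exact: ex_derive.
  split; [by move=> x _; exact: ex_derive| |].
  + apply: cvg_at_right_filter; exact: cF.
  + apply: cvg_at_left_filter; exact: cF.
- by move=> x _; rewrite derive1E; apply: derive_val.
Qed.

Lemma Rintegral_cosZ (y : R) : y != 0 ->
  (\int[lebesgue_measure]_(s in `[(-1)%R, 1%R]) cos (y * s))%R = 2 * sin y / y.
Proof.
move=> y0.
transitivity (sin (y * 1) / y - sin (y * -1) / y); last first.
  by rewrite mulr1 mulrN1 sinN; ring.
apply: (@Rintegral_FTC _ (fun s => sin (y * s) / y)).
- lra.
- have -> : (fun s => cos (y * s)) = (fun s => cos (y * s - 0)).
    by apply/funext => s; rewrite subr0.
  exact: continuous_cosZB.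
- move=> x.
  have h1 : is_derive x 1 (fun s : R => y * s) y.
    have := @is_deriveZ _ _ _ (@id R) y x 1 1 _.
    by rewrite /GRing.scale/= mulr1; apply.
  have h2 : is_derive x 1 (fun s : R => sin (y * s)) (cos (y * x) * y).
    by have := @is_derive1_comp _ sin (fun s : R => y * s) x _ _ (is_derive_sin (y * x)) h1.
  have -> : (fun s => sin (y * s) / y) = y^-1 *: (fun s => sin (y * s)).
    by apply/funext => s; rewrite mulrC.
  apply: is_derive_eq.
  by rewrite /GRing.scale/= mulrC mulfK.
Qed.

Lemma Rintegral_exprn2 n :
  (\int[lebesgue_measure]_(s in `[(-1)%R, 1%R]) s ^+ n.*2)%R = 2 / n.*2.+1%:R :> R.
Proof.
transitivity (n.*2.+1%:R^-1 * 1 ^+ n.*2.+1 - n.*2.+1%:R^-1 * (-1) ^+ n.*2.+1 : R); last first.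
  by rewrite expr1n -signr_odd/= odd_double expr1; ring.
apply: (@Rintegral_FTC _ (fun s => n.*2.+1%:R^-1 * s ^+ n.*2.+1)).
- lra.
- exact: continuous_fX.
- move=> x.
  have -> : (fun s : R => n.*2.+1%:R^-1 * s ^+ n.*2.+1) =
      n.*2.+1%:R^-1 *: ((@id R) ^+ n.*2.+1).
    by apply/funext => s /=; rewrite fctE.
  apply: is_derive_eq.
  by rewrite /GRing.scale/= mulr1 mulrA mulVf ?mul1r// pnatr_eq0.
Qed.

End ContinuousFunctions.

(** * Means with respect to the density omega *)

Section WeightedMean.
Variables (R : realType) (omega : R -> R).
Hypothesis adm : admissible omega.
Implicit Types f g : R -> R.

Local Notation D := (`[(-1)%R, 1%R]%classic : set R).
Local Notation mu := (@lebesgue_measure R).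

Definition wmean g : R := (\int[mu]_(s in D) (g s * omega s))%R.

Let mD : measurable D. Proof. exact: measurable_itv. Qed.

Let muD_fin : (mu D < +oo)%E.
Proof. by rewrite lebesgue_measure_itv/=; case: ifP => _; rewrite ?ltry// -EFinB ltry. Qed.

Lemma omega_ge0 s : D s -> 0 <= omega s.
Proof. by case: adm => _ h _ _; rewrite /= in_itv/= => /h. Qed.

Lemma omega_bound : exists2 M : R, 0 < M & forall s, D s -> omega s <= M.
Proof.
case: adm => _ _ [M hM] _; exists (`|M| + 1); first by rewrite ltr_wpDl.
move=> s; rewrite /= in_itv/= => /hM h; apply: (le_trans h).
by apply: le_trans (ler_norm _) _; rewrite lerDl.
Qed.

Lemma continuous_boundD g : continuous g ->
  exists2 G : R, 0 <= G & forall s, D s -> `|g s| <= G.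
Proof.
move=> cg; have cn : {within D, continuous (fun s => `|g s|)}.
  apply: continuous_subspaceT => s; apply: cvg_norm; exact: cg.
have [|c _ hc] := EVT_max _ cn; first lra.
by exists `|g c| => // s Ds; apply: hc.
Qed.

Lemma integrable_continuousD g : continuous g -> mu.-integrable D (EFin \o g).
Proof.
move=> cg; apply: continuous_compact_integrable; first exact: segment_compact.
exact: continuous_subspaceT.
Qed.

Lemma integrable_weighted g : continuous g ->
  mu.-integrable D (EFin \o (fun s => g s * omega s)).
Proof.
move=> cg; have [G G0 hG] := continuous_boundD cg.
have [M M0 hM] := omega_bound.
apply: measurable_bounded_integrable => //.
  apply: measurable_funM.
    by apply: measurable_funTS; exact: continuous_measurable_fun.
  by case: adm.
exists (G * M); split; first exact: num_real.
move=> x Gx s Ds; apply: le_trans (ltW Gx).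
rewrite normrM ler_pM ?normr_ge0 ?hG// ger0_norm ?hM//; exact: omega_ge0.
Qed.

Lemma wmean_cst k : wmean (fun=> k) = k.
Proof.
have icst : continuous (fun _ : R => 1 : R) by move=> s; exact: cvg_cst.
have i1 := integrable_weighted icst.
have E : (\int[mu]_(s in D) (1 * omega s))%R = 1.
  rewrite /Rintegral; under eq_integral do rewrite mul1r.
  by case: adm => _ _ _ ->.
transitivity (k * (\int[mu]_(s in D) (1 * omega s))%R); last by rewrite E mulr1.
rewrite -RintegralZl//.
by apply: eq_Rintegral => s _; rewrite mul1r.
Qed.

Lemma wmeanZ k g : continuous g -> wmean (fun s => k * g s) = k * wmean g.
Proof.
move=> cg; rewrite /wmean -RintegralZl//; last exact: integrable_weighted.
by apply: eq_Rintegral => s _; rewrite mulrA.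
Qed.

Lemma wmeanB f g : continuous f -> continuous g ->
  wmean (fun s => f s - g s) = wmean f - wmean g.
Proof.
move=> cf cg; rewrite /wmean -RintegralB//; [|exact: integrable_weighted..].
by apply: eq_Rintegral => s _; rewrite mulrBl.
Qed.

Lemma wmean_sum (I : Type) (r : seq I) (h : I -> R -> R) :
  (forall i, continuous (h i)) ->
  wmean (fun s => \sum_(i <- r) h i s) = \sum_(i <- r) wmean (h i).
Proof.
move=> ch; rewrite /wmean -Rintegral_sum//; last by move=> i; exact: integrable_weighted.
by apply: eq_Rintegral => s _; rewrite mulr_suml.
Qed.

Lemma le_wmean f g : continuous f -> continuous g ->
  (forall s, -1 <= s <= 1 -> f s <= g s) -> wmean f <= wmean g.
Proof.
move=> cf cg fg; apply: le_Rintegral => //; [exact: integrable_weighted..|].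
move=> s Ds; rewrite ler_wpM2r ?omega_ge0//; apply: fg.
by move: Ds; rewrite /= in_itv.
Qed.

Lemma eq_wmean f g : (forall s, f s = g s) -> wmean f = wmean g.
Proof. by move=> fg; apply: eq_Rintegral => s _; rewrite fg. Qed.

(** Jensen's inequality for the square, the mean of (g - wmean g)^2 being
    non-negative. *)
Lemma wmean_sqr g : continuous g -> wmean g ^+ 2 <= wmean (fun s => g s ^+ 2).
Proof.
move=> cg; set a := wmean g.
have ca : continuous (fun _ : R => a) by move=> s; exact: cvg_cst.
have cg2 : continuous (fun s => g s ^+ 2) by apply: continuous_fM.
have : wmean (fun=> 0) <= wmean (fun s => (g s ^+ 2 - (2 * a) * g s) - (- a ^+ 2)).
  apply: le_wmean.
  - by move=> s; exact: cvg_cst.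
  - apply: continuous_fB; last by move=> s; exact: cvg_cst.
    by apply: continuous_fB => //; exact: continuous_fZ.
  - by move=> s _; have := sqr_ge0 (g s - a); rewrite sqrrB; lra.
rewrite wmeanB//; last 2 first.
- by apply: continuous_fB => //; exact: continuous_fZ.
- by move=> s; exact: cvg_cst.
rewrite wmeanB//; last exact: continuous_fZ.
by rewrite wmeanZ// !wmean_cst -/a; lra.
Qed.

Lemma wmean_le_integral M g : (forall s, -1 <= s <= 1 -> omega s <= M) ->
  continuous g -> (forall s, 0 <= g s) ->
  wmean g <= M * (\int[mu]_(s in D) g s)%R.
Proof.
move=> hM cg g0; rewrite -RintegralZl//; last exact: integrable_continuousD.
apply: le_Rintegral => //; first exact: integrable_weighted.
  apply: (@integrable_RZl _ _ _ mu D mD); exact: integrable_continuousD.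
by move=> s Ds; rewrite mulrC ler_wpM2r// hM//; move: Ds; rewrite /= in_itv.
Qed.

Lemma norm_wmean_le1 g : continuous g -> (forall s, -1 <= s <= 1 -> `|g s| <= 1) ->
  `|wmean g| <= 1.
Proof.
move=> cg g1; rewrite ler_norml; apply/andP; split.
  rewrite -(wmean_cst (-1)); apply: le_wmean => //; first by move=> s; exact: cvg_cst.
  by move=> s /g1; rewrite ler_norml => /andP[].
rewrite -(wmean_cst 1); apply: le_wmean => //; first by move=> s; exact: cvg_cst.
by move=> s /g1; rewrite ler_norml => /andP[].
Qed.

Lemma cvg_wmean (h : nat -> R -> R) g (B : R) :
  (forall n, continuous (h n)) -> continuous g ->
  (forall n s, -1 <= s <= 1 -> `|h n s| <= B) ->
  (forall s, h n s @[n --> \oo] --> g s) ->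
  wmean (h n) @[n --> \oo] --> wmean g.
Proof.
move=> ch cg hB hg; have [M M0 hM] := omega_bound.
have mh n : measurable_fun D (fun s => h n s * omega s).
  by have /measurable_int/measurable_EFinP := integrable_weighted (ch n).
have mg : measurable_fun D (fun s => g s * omega s).
  by have /measurable_int/measurable_EFinP := integrable_weighted cg.
have [] := @dominated_convergence _ _ _ mu D mD
  (fun n s => (h n s * omega s)%:E) (fun s => (g s * omega s)%:E)
  (cst (B * M)%:E).
- by move=> n; apply/measurable_EFinP; exact: mh.
- by apply/measurable_EFinP; exact: mg.
- apply/aeW => s _; apply: cvg_EFin; first by near=> n.
  by apply: cvgM; [exact: hg|exact: cvg_cst].
- by apply: measurable_bounded_integrable => //; exists `|B * M|; split;
    [exact: num_real | move=> x /ltW hx s _].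
- apply/aeW => s n Ds /=; rewrite lee_fin normrM ler_pM//.
    by apply: hB; move: Ds; rewrite /= in_itv.
  by rewrite ger0_norm ?hM//; exact: omega_ge0.
move=> ig _ H; rewrite /wmean /Rintegral; apply: fine_cvg.
by rewrite fineK//; exact: integrable_fin_num.
Unshelve. all: by end_near. Qed.

End WeightedMean.

(** * The Riemann-Lebesgue lemma *)

Section RiemannLebesgue.
Variable R : realType.

Local Notation D := (`[(-1)%R, 1%R]%classic : set R).
Local Notation mu := (@lebesgue_measure R).

Let mD : measurable D. Proof. exact: measurable_itv. Qed.

Lemma continuous_cosZ (y : R) : continuous (fun s : R => cos (y * s)).
Proof.
have -> : (fun s : R => cos (y * s)) = (fun s => cos (y * s - 0)).
  by apply/funext => s; rewrite subr0.
exact: continuous_cosZB.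
Qed.

Lemma integral_cos_bound (N y : R) : 0 < N -> N <= `|y| ->
  `|(\int[mu]_(s in D) cos (y * s))%R| <= 2 / N.
Proof.
move=> N0 Ny; have y0 : 0 < `|y| by exact: lt_le_trans Ny.
rewrite Rintegral_cosZ -?normr_gt0// !normrM normfV.
rewrite ger0_norm// -mulrA ler_pM2l//.
apply: (@le_trans _ _ (1 / `|y|)).
  by rewrite ler_pM2r ?invr_gt0// ler_norml sin_geN1 sin_le1.
by rewrite mul1r lef_pV2 ?posrE.
Qed.

(** Waves of distant frequencies are almost orthogonal, their product being a
    half-sum of waves of frequencies y - y' and y + y'. *)
Lemma gram_cos_off (N y y' : R) : 0 < N -> N <= `|y - y'| -> N <= `|y + y'| ->
  `|(\int[mu]_(s in D) (cos (y * s) * cos (y' * s)))%R| <= 2 / N.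
Proof.
move=> N0 h1 h2.
have -> : (\int[mu]_(s in D) (cos (y * s) * cos (y' * s)))%R =
    2^-1 * (\int[mu]_(s in D) cos ((y - y') * s))%R +
    2^-1 * (\int[mu]_(s in D) cos ((y + y') * s))%R.
  have ic z := integrable_continuousD (@continuous_cosZ z).
  have ich z := @integrable_RZl _ _ _ mu D mD 2^-1 _ (ic z).
  rewrite -!RintegralZl// -RintegralD//.
  apply: eq_Rintegral => s _; rewrite mulrBl mulrDl cosB cosD; lra.
apply: le_trans (ler_normD _ _) _; rewrite !normrM ger0_norm//.
have := integral_cos_bound N0 h1; have := integral_cos_bound N0 h2; lra.
Qed.

Lemma gram_cos_diag (y : R) :
  (\int[mu]_(s in D) (cos (y * s) * cos (y * s)))%R <= 2.
Proof.
have -> : 2 = (\int[mu]_(s in D) (1 : R))%R.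
  by have := @Rintegral_exprn2 R 0; under eq_Rintegral do rewrite expr0; rewrite divr1.
apply: le_Rintegral => //.
- apply: integrable_continuousD; apply: continuous_fM; exact: continuous_cosZ.
- by apply: integrable_continuousD => s; exact: cvg_cst.
Qed.

(** The Riemann-Lebesgue lemma for a bounded density, by a Bessel-type argument
    that needs no approximation of omega: if the cosine transform exceeded eps
    at frequencies y_1, ..., y_n whose gaps are at least n, the signed sum S of
    the waves cos (y_i s) would have a mean at least n eps, whereas
    near-orthogonality bounds the integral of S^2 by 4 n and Jensen's
    inequality then gives (n eps)^2 <= 4 M n. *)
Lemma riemann_lebesgue (omega : R -> R) (eps : R) : admissible omega -> 0 < eps ->
  exists Y : R, forall y : R, Y <= `|y| ->
    `|wmean omega (fun s => cos (y * s))| <= eps.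
Proof.
move=> adm eps0; have [M M0 hM] := omega_bound adm.
pose psi (y : R) := wmean omega (fun s => cos (y * s)).
apply: contrapT => /forallNP noY.
have {noY} noY (Y : R) : exists y : R, Y <= y /\ eps < `|psi y|.
  have /existsNP[y /not_implyP[Yy /negP]] := noY Y; rewrite -ltNge => hy.
  exists `|y|; split => //; rewrite /psi.
  suff -> : (fun s : R => cos (`|y| * s)) = (fun s => cos (y * s)) by [].
  apply/funext => s; case: (ger0P y) => // _.
  by rewrite mulNr cosN.
have [f hf] := choice noY.
(* n > 4 M / eps^2 frequencies suffice for the contradiction. *)
pose n := (Num.truncn (4 * M / eps ^+ 2)).+1.
have nM : 4 * M < n%:R * eps ^+ 2.
  rewrite -ltr_pdivrMr ?exprn_gt0//; exact: truncnS_gt.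
pose K : R := n%:R; have K0 : 0 < K by rewrite /K ltr0n.
(* The gaps and the sums of the frequencies are all at least n, which makes the
   off-diagonal Gram entries at most 2 / n. *)
pose y := fix y k := if k is k'.+1 then f (y k' + K) else f K.
have yS k : y k + K <= y k.+1 by exact: (hf _).1.
have yge k : K <= y k.
  elim: k => [|k ih]; first exact: (hf _).1.
  by apply: le_trans (yS k); rewrite lerDr (le_trans _ ih)// ltW.
have ygap i j : (i < j)%N -> y i + K <= y j.
  elim: j => // j ih; rewrite ltnS leq_eqVlt => /predU1P[->|/ih h]; first exact: yS.
  by apply: (le_trans h); apply: le_trans (yS j); rewrite lerDl ltW.
have psiy k : eps < `|psi (y k)| by case: k => [|k]; exact: (hf _).2.
pose sg i := Num.sg (psi (y i)).
pose S s := \sum_(i < n) sg i * cos (y i * s).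
have cS1 (i : 'I_n) : continuous (fun s => sg i * cos (y i * s)).
  by apply: continuous_fZ; exact: continuous_cosZ.
have cS : continuous S by exact: continuous_fsum.
have lb : n%:R * eps <= wmean omega S.
  rewrite /S wmean_sum// -[n in n%:R]card_ord mulr_natl -sumr_const.
  apply: ler_sum => i _; rewrite wmeanZ//; last exact: continuous_cosZ.
  by rewrite -/(psi _) -normrEsg ltW.
have IS : (\int[mu]_(s in D) S s ^+ 2)%R <= 4 * n%:R.
  have -> : (\int[mu]_(s in D) S s ^+ 2)%R = \sum_(i < n) \sum_(j < n)
      sg i * sg j * (\int[mu]_(s in D) (cos (y i * s) * cos (y j * s)))%R.
    have ic (i j : 'I_n) : mu.-integrable D (EFin \o (fun s =>
        sg i * sg j * (cos (y i * s) * cos (y j * s)))).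
      apply: integrable_continuousD; apply: continuous_fZ.
      by apply: continuous_fM; exact: continuous_cosZ.
    transitivity (\int[mu]_(s in D) \sum_(i < n) \sum_(j < n)
        sg i * sg j * (cos (y i * s) * cos (y j * s)))%R.
      apply: eq_Rintegral => s _; rewrite expr2 /S mulr_suml.
      by apply: eq_bigr => i _; rewrite mulr_sumr; apply: eq_bigr => j _; ring.
    rewrite Rintegral_sum//; last by move=> i; apply: integrable_Rsum.
    apply: eq_bigr => i _; rewrite Rintegral_sum//.
    apply: eq_bigr => j _; rewrite RintegralZl//.
    apply: integrable_continuousD.
    by apply: continuous_fM; exact: continuous_cosZ.
  rewrite mulrC mulr_natl -[X in _ *+ X]card_ord -sumr_const.
  apply: ler_sum => i _.
  have sg1 k : `|sg k| <= 1 by rewrite normr_sg; case: (_ == _).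
  apply: (@le_trans _ _ (\sum_(j < n) ((if j == i then 2 else 0) + 2 / K))).
    apply: ler_sum => j _; case: eqVneq => [->|ji].
      apply: (@le_trans _ _ 2); last by rewrite lerDl divr_ge0// ltW.
      apply: le_trans (gram_cos_diag (y i)).
      rewrite ler_piMl//.
        apply: Rintegral_ge0 => s _; by rewrite -expr2 sqr_ge0.
      apply: le_trans (ler_norm _) _; rewrite normrM mulr_ile1//.
    rewrite add0r; apply: le_trans (ler_norm _) _; rewrite !normrM.
    have g : `|(\int[mu]_(s in D) (cos (y i * s) * cos (y j * s)))%R| <= 2 / K.
      apply: gram_cos_off => //.
        have [ij|ij|/val_inj ij] := ltngtP i j.
        - by rewrite distrC; apply: le_trans (ler_norm _); have := ygap _ _ ij; lra.
        - by apply: le_trans (ler_norm _); have := ygap _ _ ij; lra.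
        - by rewrite ij eqxx in ji.
      by apply: le_trans (ler_norm _); have := yge i; have := yge j; move: K0; lra.
    by apply: le_trans g; rewrite ler_piMl// mulr_ile1.
  rewrite big_split/= -big_mkcond/= big_pred1_eq sumr_const card_ord.
  by rewrite -[X in _ + X]mulr_natl mulrCA divff ?gt_eqF//; lra.
have h1 := wmean_sqr adm cS.
have h2 : wmean omega (fun s => S s ^+ 2) <= M * (4 * n%:R).
  apply: (@le_trans _ _ (M * (\int[mu]_(s in D) S s ^+ 2)%R)); last first.
    by rewrite ler_pM2l.
  have hM' s : -1 <= s <= 1 -> omega s <= M.
    by move=> Ds; apply: hM; rewrite /= in_itv.
  apply: wmean_le_integral => //; last by move=> s; exact: sqr_ge0.
  exact: continuous_fM.
have h3 : (n%:R * eps) ^+ 2 <= wmean omega S ^+ 2.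
  by rewrite lerXn2r// ?nnegrE ?mulr_ge0 ?(ltW eps0)//; apply: le_trans lb; rewrite mulr_ge0// ltW.
have : (n%:R * eps) ^+ 2 <= M * (4 * n%:R) by apply: le_trans h3 (le_trans h1 h2).
apply/negP; rewrite -ltNge.
have -> : M * (4 * n%:R) = n%:R * (4 * M) by ring.
have -> : (n%:R * eps) ^+ 2 = n%:R * (n%:R * eps ^+ 2) by ring.
by rewrite ltr_pM2l.
Qed.

End RiemannLebesgue.

(** * The kernel and its mean *)

Section TrigonometricSeries.
Variable R : realType.
Implicit Types a b : R.

Lemma sum_exp_coeff_le a n : 0 <= a ->
  \sum_(0 <= k < n) a ^+ k / k`!%:R <= expR a.
Proof.
move=> a0; rewrite /expR; apply: nondecreasing_cvgn_le; last first.
  exact: is_cvg_series_exp_coeff.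
apply/nondecreasing_seqP => k; rewrite seriesSr lerDl.
exact: exp_coeff_ge0.
Qed.

Lemma trig_quarter_turns k :
  (cos (pi * k%:R / 2) = (~~ odd k)%:R * (-1) ^+ k./2 :> R) /\
  (sin (pi * k%:R / 2) = (odd k)%:R * (-1) ^+ k.-1./2 :> R).
Proof.
elim: k => [|k [ihc ihs]]; first by rewrite mulr0 mul0r cos0 sin0 mul0r mul1r expr0.
have -> : pi * k.+1%:R / 2 = pi * k%:R / 2 + pi / 2 :> R.
  by rewrite -natr1 mulrDr mulr1 mulrDl.
rewrite cosD sinD cos_pihalf sin_pihalf !mulr0 !mulr1 sub0r add0r ihc ihs /=.
case: k {ihc ihs} => [|k]; first by rewrite /= !mul0r oppr0.
rewrite /= !negbK; split => //.
case: (odd k); rewrite ?mul0r ?oppr0//= !mul1r.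
by rewrite exprS mulN1r.
Qed.

(** The real part of exp (- i b) times the exponential series at i a. *)
Lemma cvg_rotated_exp_series a b :
  series (fun k => a ^+ k / k`!%:R * cos (pi * k%:R / 2 - b)) n @[n --> \oo]
    --> cos (a - b).
Proof.
have -> : series (fun k => a ^+ k / k`!%:R * cos (pi * k%:R / 2 - b)) =
    (fun n => cos b * series (cos_coeff a) n + sin b * series (sin_coeff a) n).
  apply/funext => n; rewrite /series/= !mulr_sumr -big_split/=.
  apply: eq_bigr => k _; have [hc hs] := trig_quarter_turns k.
  by rewrite cosB hc hs /cos_coeff /sin_coeff/= -exprnP; ring.
have -> : cos (a - b) = cos b * cos a + sin b * sin a by rewrite cosB; ring.
have hc : series (cos_coeff a) n @[n --> \oo] --> cos a.
  by rewrite unlock; exact: is_cvg_series_cos_coeff.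
have hs : series (sin_coeff a) n @[n --> \oo] --> sin a.
  by rewrite unlock; exact: is_cvg_series_sin_coeff.
by apply: cvgD; apply: cvgM => //; exact: cvg_cst.
Qed.

End TrigonometricSeries.

Section Kernel.
Variables (R : realType) (c : nat -> {posnum R}) (theta0 : R) (omega : R -> R).
Hypothesis L0_fin : (nef_L c theta0 < +oo)%E.
Hypothesis adm : admissible omega.

Local Notation H := (nef_H c).
Local Notation eta0 := (expR theta0).

Definition nef_pmf (theta : R) (k : nat) : R :=
  (c k)%:num * expR theta ^+ k / H (expR theta).

Definition kernel_wave (t : R) (x : nat) (s : R) : R :=
  s ^+ x * cos (pi * x%:R / 2 - t * s * eta0).

Lemma continuous_kernel_wave t x : continuous (kernel_wave t x).
Proof.
apply: continuous_fM; first exact: continuous_fX.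
have -> : (fun s => cos (pi * x%:R / 2 - t * s * eta0)) =
    (fun s => cos ((t * eta0) * s - pi * x%:R / 2)).
  by apply/funext => s; rewrite -cosN opprB mulrAC.
exact: continuous_cosZB.
Qed.

Lemma kernel_wave_le1 t x s : -1 <= s <= 1 -> `|kernel_wave t x s| <= 1.
Proof.
move=> s1; rewrite normrM mulr_ile1 ?cos_max// normrX exprn_ile1//.
by rewrite ler_norml.
Qed.

Lemma kernel_KE t x : kernel_K c theta0 omega t x =
  H eta0 * t ^+ x / ((c x)%:num * x`!%:R) * wmean omega (kernel_wave t x).
Proof.
rewrite /kernel_K (derive1n_nef_H L0_fin).
have -> : H eta0 * t ^+ x / ((c x)%:num * x`!%:R) * wmean omega (kernel_wave t x) =
    H eta0 * (t ^+ x / ((c x)%:num * x`!%:R) * wmean omega (kernel_wave t x)) by ring.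
rewrite -wmeanZ//; last exact: continuous_kernel_wave.
congr (_ * _); apply: eq_Rintegral => s _; rewrite /kernel_wave exprMn; ring.
Qed.

Lemma norm_kernel_K_le t x : 0 <= t ->
  `|kernel_K c theta0 omega t x| <= H eta0 * t ^+ x / ((c x)%:num * x`!%:R).
Proof.
move=> t0; rewrite kernel_KE normrM ger0_norm; last first.
  by rewrite divr_ge0// mulr_ge0 ?exprn_ge0// ltW// nef_H_gt0.
rewrite ler_piMr//.
  by rewrite divr_ge0// mulr_ge0 ?exprn_ge0// ltW// nef_H_gt0.
apply: norm_wmean_le1 => //; first exact: continuous_kernel_wave.
by move=> s; exact: kernel_wave_le1.
Qed.

(** The factor 2 M / (2 x + 1) bounds the moment of order 2 x of omega; it is what
    makes the variance negligible against the smallest proportion pi_1 of the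
    first class. *)
Lemma sqr_kernel_K_le M t x : 0 <= M -> (forall s, -1 <= s <= 1 -> omega s <= M) ->
  kernel_K c theta0 omega t x ^+ 2 <=
  (H eta0 * t ^+ x / ((c x)%:num * x`!%:R)) ^+ 2 * (2 * M / x.*2.+1%:R).
Proof.
move=> M0 hM; rewrite kernel_KE exprMn ler_wpM2l ?sqr_ge0//.
have cw := @continuous_kernel_wave t x.
apply: le_trans (wmean_sqr adm cw) _.
have cx : continuous (fun s : R => s ^+ x.*2) by exact: continuous_fX.
apply: (@le_trans _ _ (wmean omega (fun s => s ^+ x.*2))).
  apply: le_wmean => //; first by apply: continuous_fM.
  move=> s s1; rewrite /kernel_wave exprMn -exprM muln2 ler_piMr//.
    by rewrite -mul2n exprM exprn_ge0// sqr_ge0.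
apply: le_trans (wmean_le_integral _ hM cx _) _ => //.
  by move=> s; rewrite -mul2n exprM exprn_ge0// sqr_ge0.
rewrite Rintegral_exprn2 le_eqVlt; apply/orP; left; apply/eqP; ring.
Qed.

Lemma nef_pmf_kernelE t theta k : nef_pmf theta k * kernel_K c theta0 omega t k =
  H eta0 / H (expR theta) *
  wmean omega (fun s => (t * expR theta * s) ^+ k / k`!%:R *
     cos (pi * k%:R / 2 - t * s * eta0)).
Proof.
have cw := @continuous_kernel_wave t k.
have -> : wmean omega (fun s => (t * expR theta * s) ^+ k / k`!%:R *
     cos (pi * k%:R / 2 - t * s * eta0)) =
   (t * expR theta) ^+ k / k`!%:R * wmean omega (kernel_wave t k).
  rewrite -wmeanZ//; apply: eq_wmean => s; rewrite /kernel_wave exprMn; ring.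
rewrite kernel_KE /nef_pmf exprMn.
have c0 : (c k)%:num != 0 by [].
have k0 : k`!%:R != 0 :> R by rewrite pnatr_eq0 -lt0n fact_gt0.
move: (H (expR theta))^-1 => Hi.
by field; rewrite c0 k0.
Qed.

(** The kernel is designed so that its coefficient c_x x! cancels the weight c_x
    of the law, whatever the family: what remains under the mean over s is the
    series of cos (t (eta - eta_0) s). *)
Lemma cvg_mean_kernel_K t theta : 0 <= t ->
  series (fun k => nef_pmf theta k * kernel_K c theta0 omega t k) n @[n --> \oo]
  --> H eta0 / H (expR theta) * wmean omega (fun s => cos (t * (expR theta - eta0) * s)).
Proof.
move=> t0.
pose h n s : R := \sum_(0 <= k < n) (t * expR theta * s) ^+ k / k`!%:R *
     cos (pi * k%:R / 2 - t * s * eta0).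
have ck k : continuous (fun s : R => (t * expR theta * s) ^+ k / k`!%:R *
     cos (pi * k%:R / 2 - t * s * eta0)).
  have -> : (fun s : R => (t * expR theta * s) ^+ k / k`!%:R *
     cos (pi * k%:R / 2 - t * s * eta0)) =
     (fun s => ((t * expR theta) ^+ k / k`!%:R) * kernel_wave t k s).
    by apply/funext => s; rewrite /kernel_wave exprMn; ring.
  by apply: continuous_fZ; exact: continuous_kernel_wave.
have -> : series (fun k => nef_pmf theta k * kernel_K c theta0 omega t k) =
   (fun n => H eta0 / H (expR theta) * wmean omega (h n)).
  apply/funext => n; rewrite /series/= /h wmean_sum// mulr_sumr.
  by apply: eq_bigr => k _; rewrite nef_pmf_kernelE.
apply: cvgM; first exact: cvg_cst.
apply: (cvg_wmean adm (B := expR (t * expR theta))).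
- by move=> n; exact: continuous_fsum.
- exact: continuous_cosZ.
- move=> n s s1; have te : 0 <= t * expR theta by rewrite mulr_ge0// expR_ge0.
  apply: le_trans (sum_exp_coeff_le n te).
  apply: le_trans (ler_norm_sum _ _ _) _; apply: ler_sum => k _.
  rewrite normrM -[leRHS]mulr1; apply: ler_pM; rewrite ?normr_ge0 ?cos_max//.
  rewrite normrM normfV normr_nat ler_wpM2r ?invr_ge0// normrX.
  rewrite lerXn2r ?nnegrE// normrM ger0_norm// ler_piMr//.
  by rewrite ler_norml.
- move=> s; have := @cvg_rotated_exp_series R (t * expR theta * s) (t * s * eta0).
  by rewrite /h; have -> : t * expR theta * s - t * s * eta0 =
    t * (expR theta - eta0) * s by ring.
Qed.

End Kernel.

(** * Exponential series and moments of the kernel *)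

Section ExponentialSeries.
Variable R : realType.
Implicit Types a q beta : R.

Lemma exp_term_le a k : 0 <= a -> a ^+ k / k`!%:R <= expR a.
Proof.
move=> a0; apply: le_trans (sum_exp_coeff_le k.+1 a0).
rewrite big_nat_recr//= lerDr; apply: sumr_ge0 => i _.
by rewrite divr_ge0// exprn_ge0.
Qed.

(** Without the factor 1 / (2 k + 1) this is a partial sum of the Bessel function
    I_0 (2 a).  The factor lets one power of a / (k + 1) be moved into the second
    of the two exponential terms, each of which is then at most exp a; this is
    where the gain 1 / a over exp (2 a) comes from. *)
Lemma sum_bessel_le a n : 0 < a ->
  \sum_(0 <= k < n) a ^+ k.*2 / (k`!%:R ^+ 2 * k.*2.+1%:R) <= expR (2 * a) / a.
Proof.
move=> a0; have -> : expR (2 * a) = expR a * expR a by rewrite -expRD; congr expR; ring.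
rewrite -mulrA; apply: le_trans (_ : (\sum_(0 <= k < n) a ^+ k / k`!%:R) * (expR a / a) <= _).
  rewrite mulr_suml; apply: ler_sum => k _.
  rewrite -addnn exprD invfM [k`!%:R ^+ 2]expr2 invfM.
  have -> : a ^+ k * a ^+ k * (k`!%:R^-1 * k`!%:R^-1 * (k + k).+1%:R^-1) =
     a ^+ k / k`!%:R * (a ^+ k / k`!%:R / (k + k).+1%:R) by ring.
  rewrite ler_wpM2l ?divr_ge0 ?exprn_ge0 ?(ltW a0)//.
  rewrite ler_pdivlMr//; apply: le_trans (exp_term_le k.+1 (ltW a0)).
  have -> : a ^+ k / k`!%:R / (k + k).+1%:R * a = a ^+ k.+1 / k`!%:R / (k + k).+1%:R.
    by rewrite exprS; ring.
  rewrite -(mulrA (a ^+ k.+1)) ler_wpM2l ?exprn_ge0 ?(ltW a0)//.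
  rewrite factS natrM invfM mulrC ler_wpM2r ?invr_ge0//.
  rewrite lef_pV2 ?posrE// ler_nat ltnS.
  exact: leq_addr.
by rewrite ler_wpM2r ?sum_exp_coeff_le ?divr_ge0 ?expR_ge0 ?(ltW a0).
Qed.

Lemma exp_tail_small a B : 0 <= a -> 0 < B ->
  exists N : nat, forall n, \sum_(N <= k < n) a ^+ k / k`!%:R <= B.
Proof.
move=> a0 B0.
have h : series (exp_coeff a) n @[n --> \oo] --> expR a by exact: is_cvg_series_exp_coeff.
have /cvgr_ge/(_ (expR a - B)) := h; rewrite ltrBlDr ltrDl => /(_ B0)[N _ hN].
exists N => n; have [Nn|nN] := leqP N n; last by rewrite big_geq ?(ltW B0)//; exact: ltnW.
have := hN N (leqnn N); have := sum_exp_coeff_le n a0.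
rewrite /series/= (big_cat_nat (leq0n N) Nn)/= => h1 h2.
have : expR a - B <= \sum_(0 <= k < N) a ^+ k / k`!%:R := h2.
by move: h1; lra.
Qed.

Let exp_tilt a beta k :
  a ^+ k / k`!%:R = expR (- (beta * k%:R)) * ((a * expR beta) ^+ k / k`!%:R).
Proof.
have k0 : k`!%:R != 0 :> R by rewrite pnatr_eq0 -lt0n fact_gt0.
have e0 : expR (beta * k%:R) != 0 by rewrite gt_eqF ?expR_gt0.
by rewrite exprMn -expRM_natr expRN; field; rewrite k0 e0.
Qed.

(** Chernoff bounds: the exponential series is tilted by exp beta, upwards for its
    tail and downwards for its head. *)
Lemma exp_tail_le a beta N n : 0 <= a -> 0 <= beta ->
  \sum_(N <= k < n) a ^+ k / k`!%:R <= expR (- (beta * N%:R)) * expR (a * expR beta).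
Proof.
move=> a0 b0; have ab0 : 0 <= a * expR beta by rewrite mulr_ge0 ?expR_ge0.
have [Nn|nN] := leqP N n; last first.
  by rewrite big_geq ?mulr_ge0 ?expR_ge0//; exact: ltnW.
apply: (@le_trans _ _ (expR (- (beta * N%:R)) *
    \sum_(N <= k < n) (a * expR beta) ^+ k / k`!%:R)).
  rewrite mulr_sumr big_nat [leRHS]big_nat; apply: ler_sum => k /andP[Nk _].
  rewrite (exp_tilt a beta) ler_wpM2r ?divr_ge0 ?exprn_ge0//.
  by rewrite ler_expR lerN2 ler_wpM2l// ler_nat.
rewrite ler_wpM2l ?expR_ge0//; apply: le_trans (sum_exp_coeff_le n ab0).
rewrite [leRHS](big_cat_nat (leq0n N) Nn)/= lerDr; apply: sumr_ge0 => k _.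
by rewrite divr_ge0 ?exprn_ge0.
Qed.

Lemma exp_head_le a beta N : 0 <= a -> 0 <= beta ->
  \sum_(0 <= k < N) a ^+ k / k`!%:R <= expR (beta * N%:R) * expR (a * expR (- beta)).
Proof.
move=> a0 b0; have ab0 : 0 <= a * expR (- beta) by rewrite mulr_ge0 ?expR_ge0.
apply: (@le_trans _ _ (expR (beta * N%:R) *
    \sum_(0 <= k < N) (a * expR (- beta)) ^+ k / k`!%:R)); last first.
  by rewrite ler_wpM2l ?expR_ge0// sum_exp_coeff_le.
rewrite mulr_sumr big_nat [leRHS]big_nat; apply: ler_sum => k /= kN.
rewrite (exp_tilt a (- beta)) mulNr opprK ler_wpM2r ?divr_ge0 ?exprn_ge0//.
by rewrite ler_expR ler_wpM2l// ler_nat ltnW.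
Qed.

End ExponentialSeries.

Section KernelMoments.
Variables (R : realType) (c : nat -> {posnum R}) (theta0 : R) (omega : R -> R).
Hypothesis L0_fin : (nef_L c theta0 < +oo)%E.
Hypothesis adm : admissible omega.
Variables (theta t : R).
Hypothesis L_fin : (nef_L c theta < +oo)%E.
Hypothesis t_ge0 : 0 <= t.

Local Notation H := (nef_H c).
Local Notation K := (kernel_K c theta0 omega t).
Local Notation p := (nef_pmf c theta).

Let H0 : 0 < H (expR theta0). Proof. exact: nef_H_gt0. Qed.
Let Hth : 0 < H (expR theta). Proof. exact: nef_H_gt0. Qed.

Lemma nef_pmf_ge0 k : 0 <= p k.
Proof. by rewrite divr_ge0 ?(ltW Hth)// mulr_ge0// exprn_ge0// expR_ge0. Qed.

Lemma abs_moment_term k :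
  p k * `|K k| <= H (expR theta0) / H (expR theta) * ((t * expR theta) ^+ k / k`!%:R).
Proof.
apply: (@le_trans _ _ (p k * (H (expR theta0) * t ^+ k / ((c k)%:num * k`!%:R)))).
  by rewrite ler_wpM2l ?nef_pmf_ge0// norm_kernel_K_le.
rewrite le_eqVlt; apply/orP; left; apply/eqP; rewrite /nef_pmf exprMn.
have c0 : (c k)%:num != 0 by [].
have k0 : k`!%:R != 0 :> R by rewrite pnatr_eq0 -lt0n fact_gt0.
by field; rewrite c0 k0 gt_eqF.
Qed.

Lemma sqr_moment_term k :
  p k * K k ^+ 2 <= H (expR theta0) ^+ 2 / H (expR theta) *
    (((c k)%:num * k`!%:R)^-1 * ((t ^+ 2 * expR theta) ^+ k / k`!%:R)).
Proof.
apply: (@le_trans _ _ (p k * (H (expR theta0) * t ^+ k / ((c k)%:num * k`!%:R)) ^+ 2)).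
  rewrite ler_wpM2l ?nef_pmf_ge0// -[leLHS]real_normK ?num_real//.
  have h := norm_kernel_K_le L0_fin adm k t_ge0.
  by rewrite lerXn2r ?nnegrE// (le_trans _ h).
rewrite le_eqVlt; apply/orP; left; apply/eqP; rewrite /nef_pmf.
have -> : (t ^+ 2 * expR theta) ^+ k = t ^+ k ^+ 2 * expR theta ^+ k.
  by rewrite exprMn exprAC.
have c0 : (c k)%:num != 0 by [].
have k0 : k`!%:R != 0 :> R by rewrite pnatr_eq0 -lt0n fact_gt0.
by field; rewrite c0 k0 gt_eqF.
Qed.

Lemma sqr_moment_bessel C M N : 0 < t -> 0 <= M ->
  (forall s, -1 <= s <= 1 -> omega s <= M) ->
  (forall k, ((c k)%:num * k`!%:R)^-1 <= C / k`!%:R) ->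
  \sum_(0 <= k < N) p k * K k ^+ 2 <=
  H (expR theta0) ^+ 2 / H (expR theta) * (2 * M * C) *
  (expR (2 * (t * expR (theta / 2))) / (t * expR (theta / 2))).
Proof.
move=> t0 M0 hM hC; set y := t * expR (theta / 2).
have y0 : 0 < y by rewrite mulr_gt0 ?expR_gt0.
have C0 : 0 <= C.
  by have := hC 0%N; rewrite fact0 divr1 mulr1; apply: le_trans; rewrite invr_ge0.
have A0 : 0 <= H (expR theta0) ^+ 2 / H (expR theta) * (2 * M * C).
  apply: mulr_ge0; last by rewrite !mulr_ge0.
  by apply: divr_ge0; [exact: sqr_ge0|exact: ltW].
apply: le_trans (ler_wpM2l A0 (sum_bessel_le N y0)).
rewrite mulr_sumr; apply: ler_sum => k _.
apply: (@le_trans _ _ (p k * ((H (expR theta0) * t ^+ k / ((c k)%:num * k`!%:R)) ^+ 2 *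
    (2 * M / k.*2.+1%:R)))).
  by rewrite ler_wpM2l ?nef_pmf_ge0// sqr_kernel_K_le.
have y2 : y ^+ k.*2 = t ^+ k ^+ 2 * expR theta ^+ k.
  have yy : y ^+ 2 = t ^+ 2 * expR theta.
    by rewrite /y exprMn -expRM_natl; congr (_ * expR _); field.
  by rewrite -mul2n exprM yy exprMn exprAC.
rewrite y2 /nef_pmf.
have c0 : (c k)%:num != 0 by [].
have k0 : k`!%:R != 0 :> R by rewrite pnatr_eq0 -lt0n fact_gt0.
have -> : (c k)%:num * expR theta ^+ k / H (expR theta) *
  ((H (expR theta0) * t ^+ k / ((c k)%:num * k`!%:R)) ^+ 2 * (2 * M / k.*2.+1%:R)) =
  H (expR theta0) ^+ 2 / H (expR theta) * (2 * M) *
  (t ^+ k ^+ 2 * expR theta ^+ k / k`!%:R / k.*2.+1%:R) * ((c k)%:num * k`!%:R)^-1.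
  by field; rewrite c0 k0 !gt_eqF.
have -> : H (expR theta0) ^+ 2 / H (expR theta) * (2 * M * C) *
  (t ^+ k ^+ 2 * expR theta ^+ k / (k`!%:R ^+ 2 * k.*2.+1%:R)) =
  H (expR theta0) ^+ 2 / H (expR theta) * (2 * M) *
  (t ^+ k ^+ 2 * expR theta ^+ k / k`!%:R / k.*2.+1%:R) * (C / k`!%:R).
  by field; rewrite k0 !gt_eqF.
rewrite ler_wpM2l//.
have e0 : 0 <= expR theta ^+ k by rewrite exprn_ge0 ?expR_ge0.
apply: mulr_ge0.
  apply: mulr_ge0; last by rewrite mulr_ge0.
  by apply: divr_ge0; [exact: sqr_ge0|exact: ltW].
by do 2 (apply: divr_ge0 => //); rewrite mulr_ge0// sqr_ge0.
Qed.

End KernelMoments.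

(** * Consistency from moment bounds *)

Section Concentration.
Variables (R : realType) (c : nat -> {posnum R}) (theta0 : R) (omega : R -> R).
Hypothesis L0_fin : (nef_L c theta0 < +oo)%E.
Hypothesis adm : admissible omega.
Variables (d : nat -> measure_display) (Omega : forall m, measurableType (d m))
    (Pr : forall m, 'rV[R]_m -> probability (Omega m) R)
    (z : forall m, 'I_m -> {mfun Omega m >-> nat}).
Hypothesis expt : nef_experiment c Pr z.

Local Notation H := (nef_H c).
Local Notation K := (kernel_K c theta0 omega).
Local Notation psi := (fun y : R => wmean omega (fun s => cos (y * s))).

Definition kernel_mean (t theta : R) : R :=
  H (expR theta0) / H (expR theta) * psi (t * (expR theta - expR theta0)).

Lemma kernel_mean_null t : kernel_mean t theta0 = 1.
Proof.
rewrite /kernel_mean divff ?gt_eqF ?nef_H_gt0// mul1r subrr mulr0.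
by under eq_wmean do rewrite mul0r cos0; rewrite wmean_cst.
Qed.

Section FixedParameter.
Variables (m : nat) (theta : 'rV[R]_m).
Hypothesis Theta_theta : forall i, nef_Theta c (theta ord0 i).

Lemma nef_experiment_pmf i k :
  Pr theta (z i @^-1` [set k]) = (nef_pmf c (theta ord0 i) k)%:E.
Proof.
have [_ /(_ i [set k])] := expt Theta_theta.
by rewrite nef_G_set1//; exact: nef_Theta_L.
Qed.

Lemma nef_experiment_pmf2 i j a b : i != j ->
  Pr theta (z i @^-1` [set a] `&` z j @^-1` [set b]) =
  (nef_pmf c (theta ord0 i) a * nef_pmf c (theta ord0 j) b)%:E.
Proof.
move=> ij; have [ind _] := expt Theta_theta.
pose A (l : 'I_m) : set nat :=
  if l == i then [set a] else if l == j then [set b] else setT.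
have := ind A; rewrite (bigD1 i)//= (bigD1 j)/=; last by rewrite eq_sym.
rewrite big1 ?mule1; last first.
  move=> l /andP[/negbTE li /negbTE lj]; rewrite /A li lj preimage_setT.
  exact: probability_setT.
have Aj : A j = [set b] by rewrite /A eq_sym (negbTE ij) eqxx.
rewrite {2}/A eqxx Aj !nef_experiment_pmf -EFinM => <-; congr (Pr _ _).
apply/seteqP; split => w /=.
  move=> [wa wb] l _; rewrite /A.
  by case: eqVneq => [->//|_]; case: eqVneq => [->//|].
move=> h; split; first by have := h i Logic.I; rewrite /A eqxx.
by have := h j Logic.I; rewrite Aj.
Qed.

(** The error of phi_hat / pi_1 is the fluctuation of the sum of kernels plus the
    kernel means of the non-null coordinates; the null ones drop out because
    their kernel has mean exactly 1. *)
Lemma phi_hat_concentration (t eps V B : R) (N : nat) :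
  (0 < m)%N -> 0 <= t -> 0 < eps -> 0 < pi1 theta0 theta ->
  (forall i, i \in nonnulls theta0 theta ->
     `|kernel_mean t (theta ord0 i)| <= eps / 2) ->
  (forall i, \sum_(0 <= k < N) nef_pmf c (theta ord0 i) k * K t k ^+ 2 <= V) ->
  (forall i n, \sum_(N <= k < n) nef_pmf c (theta ord0 i) k * `|K t k| <= B) ->
  ((1 - (36 / eps ^+ 2 * (V / (m%:R * pi1 theta0 theta ^+ 2)) +
         6 / eps * (B / pi1 theta0 theta)))%:E <=
   Pr theta [set w | (`|(pi1 theta0 theta)^-1 *
     phi_hat c theta0 omega t (fun i => z i w) - 1| <= eps)%R])%E.
Proof.
move=> m0 t0 eps0 p0 hmean hV hB; set p := pi1 theta0 theta in p0 *.
have mR : 0 < m%:R :> R by rewrite ltr0n.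
set a := eps / 2 * (m%:R * p).
have a0 : 0 < a by apply: mulr_gt0; [exact: divr_gt0|exact: mulr_gt0].
have Lth i : (nef_L c (theta ord0 i) < +oo)%E by exact: nef_Theta_L.
have := @deviation_observable _ _ R (Pr theta) m (@z m)
  (fun i => nef_pmf c (theta ord0 i)) nef_experiment_pmf nef_experiment_pmf2
  N (K t) (fun i => kernel_mean t (theta ord0 i)) V B a hV hB
  (fun i => cvg_mean_kernel_K L0_fin adm t0) a0.
set E := [set w | _]; move=> PE.
have mE : measurable E.
  rewrite -[E]setTI; apply: measurable_fun_le => //.
  apply: measurableT_comp => //; apply: measurable_sum => i.
  apply: measurable_funB => //.
  exact: (@measurableT_comp _ _ _ _ _ _ (K t)).
set G := [set w | _].
have mG : measurable G.
  rewrite -[G]setTI; apply: measurable_fun_le => //.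
  apply: measurableT_comp => //; apply: measurable_funB => //.
  apply: measurable_funM => //; apply: measurable_funM => //.
  apply: measurable_sum => i; apply: measurable_funB => //.
  exact: (@measurableT_comp _ _ _ _ _ _ (K t)).
have PEC : (1 - Pr theta E <= Pr theta G)%E.
  rewrite -probability_setC//; apply: le_measure; rewrite ?inE//; first exact: measurableC.
  move=> w; rewrite /E /G/= => /negP; rewrite -ltNge => hw.
  have -> : p^-1 * phi_hat c theta0 omega t (fun i => z i w) - 1 =
     - (m%:R * p)^-1 * (\sum_(i < m) (K t (z i w) - kernel_mean t (theta ord0 i)) +
       \sum_(i in nonnulls theta0 theta) kernel_mean t (theta ord0 i)).
    rewrite /phi_hat.
    have -> : \sum_(i in nonnulls theta0 theta) kernel_mean t (theta ord0 i) =
       \sum_(i < m) kernel_mean t (theta ord0 i) - (m%:R - m%:R * p).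
      rewrite [in RHS](bigID (mem (nonnulls theta0 theta)))/=.
      have -> : \sum_(i | i \notin nonnulls theta0 theta) kernel_mean t (theta ord0 i) =
          m%:R - m%:R * p.
        transitivity (\sum_(i | i \notin nonnulls theta0 theta) (1 : R)).
          by apply: eq_bigr => i; rewrite inE negbK => /eqP ->; rewrite kernel_mean_null.
        rewrite sumr_const; have := cardC (mem (nonnulls theta0 theta)).
        rewrite card_ord => mE'; rewrite /p /pi1 mulrCA divff ?gt_eqF// mulr1.
        by rewrite -[X in X%:R - _]mE' natrD addrAC subrr add0r.
      by rewrite addrK.
    rewrite !sumrB sumr_const card_ord.
    by field; rewrite !gt_eqF.
  have mp0 : 0 < m%:R * p by exact: mulr_gt0.
  rewrite normrM normrN normfV (gtr0_norm mp0) ler_pdivrMl//.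
  apply: le_trans (ler_normD _ _) _.
  have h2 : `|\sum_(i in nonnulls theta0 theta) kernel_mean t (theta ord0 i)| <= a.
    apply: le_trans (ler_norm_sum _ _ _) _.
    apply: (@le_trans _ _ (\sum_(i in nonnulls theta0 theta) eps / 2)).
      by apply: ler_sum => i; exact: hmean.
    have -> : a = eps / 2 * #|nonnulls theta0 theta|%:R.
      by rewrite /a /p /pi1; field; rewrite gt_eqF.
    by rewrite sumr_const mulr_natr.
  have -> : m%:R * p * eps = a + a by rewrite /a; field.
  by rewrite lerD// ltW.
apply: le_trans PEC; rewrite EFinB; apply: leeB => //.
apply: le_trans PE _; rewrite lee_fin le_eqVlt; apply/orP; left; apply/eqP.
by rewrite /a; field; rewrite !gt_eqF.
Qed.

End FixedParameter.

(** All that depends on the class is a truncation level N for which the truncated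
    second moment V and the tail first moment B are negligible. *)
Lemma uniform_consistency_of_moments (Q : forall m, set ('rV[R]_m * R)) (u : nat -> R) :
  u n @[n --> \oo] --> +oo ->
  (forall m theta t t', Q m (theta, t) -> Q m (theta, t') -> t = t') ->
  (forall m theta t i, Q m (theta, t) -> nef_Theta c (theta ord0 i)) ->
  (forall m theta t, Q m (theta, t) -> ((u m)%:E <= t%:E * min_gap theta0 theta)%E) ->
  (forall kappa, 0 < kappa -> \forall m \near \oo, forall (theta : 'rV[R]_m) t,
     Q m (theta, t) -> [/\ 0 <= t, 0 < pi1 theta0 theta & exists N V B,
       [/\ (forall i, \sum_(0 <= k < N) nef_pmf c (theta ord0 i) k * K t k ^+ 2 <= V),
           (forall i n, \sum_(N <= k < n) nef_pmf c (theta ord0 i) k * `|K t k| <= B),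
           V / (m%:R * pi1 theta0 theta ^+ 2) <= kappa &
           B / pi1 theta0 theta <= kappa]]) ->
  uniform_consistency_class c theta0 omega Pr z Q.
Proof.
move=> uy Qt QT Qgap Qmom eps delta eps0 delta0.
pose D0 := H (expR theta0) / (c 0%N)%:num.
have H0 : 0 < H (expR theta0) by exact: nef_H_gt0.
have D00 : 0 < D0 by rewrite divr_gt0.
(* D0 bounds the ratio H(eta_0) / H(eta) in the mean of the kernel. *)
have [Y hY] := riemann_lebesgue adm (divr_gt0 (divr_gt0 eps0 (ltr0n R 2)) D00).
pose kappa := delta / (36 / eps ^+ 2 + 6 / eps).
have k1 : 0 < 36 / eps ^+ 2 + 6 / eps by rewrite addr_gt0// divr_gt0 ?exprn_gt0.
have kappa0 : 0 < kappa by rewrite divr_gt0.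
near=> m => theta [t Qm].
have m0 : (0 < m)%N by near: m; exact: nbhs_infty_gt.
have uY : Y <= u m by near: m; move/cvgryPge : uy; exact.
have [t0 p0 [N [V [B [hV hB kV kB]]]]] : [/\ 0 <= t, 0 < pi1 theta0 theta & exists N V B,
       [/\ (forall i, \sum_(0 <= k < N) nef_pmf c (theta ord0 i) k * K t k ^+ 2 <= V),
           (forall i n, \sum_(N <= k < n) nef_pmf c (theta ord0 i) k * `|K t k| <= B),
           V / (m%:R * pi1 theta0 theta ^+ 2) <= kappa &
           B / pi1 theta0 theta <= kappa]].
  by move: theta t Qm; near: m; exact: Qmom.
have secE : [set t | Q m (theta, t)] = [set t].
  by apply/seteqP; split => t' /=; [move=> /Qt; apply|move=> ->].
have Th i : nef_Theta c (theta ord0 i) by exact: (QT _ _ _ _ Qm).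
have hmean i : i \in nonnulls theta0 theta -> `|kernel_mean t (theta ord0 i)| <= eps / 2.
  move=> iI; rewrite /kernel_mean normrM ger0_norm; last first.
    by rewrite divr_ge0// ltW// nef_H_gt0//; exact: nef_Theta_L.
  apply: (@le_trans _ _ (D0 * (eps / 2 / D0))); last by rewrite mulrC divfK// gt_eqF.
  apply: ler_pM => //.
  - by rewrite divr_ge0// ltW// nef_H_gt0//; exact: nef_Theta_L.
  - rewrite ler_wpM2l ?(ltW H0)// lef_pV2 ?posrE//.
      by apply: nef_H_ge; exact: nef_Theta_L.
    by apply: nef_H_gt0; exact: nef_Theta_L.
  - apply: hY; apply: (le_trans uY); rewrite -lee_fin.
    apply: le_trans (Qgap _ _ _ Qm) _.
    rewrite normrM ger0_norm// EFinM; apply: lee_wpmul2l; first by rewrite lee_fin.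
    rewrite /min_gap distrC.
    have ee : Defs.eta theta ord0 i = expR (theta ord0 i) by rewrite mxE.
    rewrite -ee.
    exact: bigmin_le_cond.
have -> : [set w | (`|((pi1 theta0 theta)^-1)%:E *
   ereal_sup [set (phi_hat c theta0 omega t0 (fun i : 'I_m => z i w))%:E
             | t0 in [set t0 | Q m (theta, t0)]] - 1| <= eps%:E)%E] =
  [set w | (`|(pi1 theta0 theta)^-1 *
     phi_hat c theta0 omega t (fun i : 'I_m => z i w) - 1| <= eps)%R].
  apply/seteqP; split => w /=; rewrite secE image_set1 ereal_sup1.
    by rewrite -EFinM -EFinB lee_fin.
  by rewrite -EFinM -EFinB lee_fin.
apply: le_trans (phi_hat_concentration Th m0 t0 eps0 p0 hmean hV hB).
rewrite lee_fin lerD2l lerN2.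
apply: (@le_trans _ _ (36 / eps ^+ 2 * kappa + 6 / eps * kappa)).
  by rewrite lerD// ler_wpM2l// divr_ge0// ?sqr_ge0 ?(ltW eps0).
by rewrite -mulrDl /kappa mulrC divfK// gt_eqF.
Unshelve. all: by end_near. Qed.

End Concentration.

(** * The two classes *)

Section Norms.
Variable R : realType.

Lemma rV_entry_le m (x : 'rV[R]_m) i : `|x ord0 i| <= `|x|.
Proof.
have -> : `|x| = mx_norm x by [].
by rewrite mx_normrE; apply: (le_trans _ (le_bigmax _ _ (ord0, i))).
Qed.

Lemma rV_norm_le m (x : 'rV[R]_m) B : 0 <= B -> (forall i, `|x ord0 i| <= B) ->
  `|x| <= B.
Proof.
move=> B0 h; have -> : `|x| = mx_norm x by [].
rewrite mx_normrE; apply: bigmax_le => // -[i j] _ /=.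
by rewrite ord1.
Qed.

(** In terms of lambda, the logarithm of the maximum norm of eta, every power of
    the norm is an exponential and all comparisons are between exponents. *)
Lemma eta_norm_expR m (theta : 'rV[R]_m) rho : (0 < m)%N -> `|theta| <= rho ->
  exists lambda, [/\ `|Defs.eta theta| = expR lambda, - rho <= lambda <= rho &
    forall i, theta ord0 i <= lambda].
Proof.
move=> m0 hrho.
have etaE i : Defs.eta theta ord0 i = expR (theta ord0 i) by rewrite mxE.
have thi i : - rho <= theta ord0 i <= rho.
  by rewrite -ler_norml; apply: le_trans hrho; exact: rV_entry_le.
have lei i : expR (theta ord0 i) <= `|Defs.eta theta|.
  by rewrite -etaE; apply: le_trans (ler_norm _) _; exact: rV_entry_le.
have n0 : 0 < `|Defs.eta theta| by apply: lt_le_trans (lei (Ordinal m0)); exact: expR_gt0.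
exists (ln `|Defs.eta theta|); split; first by rewrite lnK.
  apply/andP; split.
    rewrite -ler_expR lnK//; apply: le_trans (lei (Ordinal m0)).
    by rewrite ler_expR; case/andP: (thi (Ordinal m0)).
  rewrite -ler_expR lnK//; apply: rV_norm_le; first exact: expR_ge0.
  move=> i; rewrite etaE ger0_norm ?expR_ge0// ler_expR.
  by case/andP: (thi i).
by move=> i; rewrite -ler_expR lnK.
Qed.

Lemma natr_expR m : (0 < m)%N -> m%:R = expR (ln m%:R) :> R.
Proof. by move=> m0; rewrite lnK// posrE ltr0n. Qed.

Lemma natr_powR m a : (0 < m)%N -> m%:R `^ a = expR (ln m%:R * a) :> R.
Proof. by move=> m0; rewrite expRM -natr_expR. Qed.

Lemma ln_natr_large (x : R) : \forall m \near \oo, x <= ln m%:R :> R.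
Proof.
near=> m; rewrite -ler_expR lnK; last by rewrite posrE ltr0n; near: m; exact: nbhs_infty_gt.
by near: m; exact: nbhs_infty_ger.
Unshelve. all: by end_near. Qed.

End Norms.

Section Classes.
Variables (R : realType) (c : nat -> {posnum R}) (theta0 rho : R).
Hypothesis rho0 : 0 < rho.

Lemma polylog_Q_II_1 (gamma : R) u : 0 < gamma -> polylog_speed (Q_II_1 c theta0 rho gamma u).
Proof.
move=> g0; exists 1, (2^-1 * expR (- rho / 2) * gamma), (2^-1 * expR (rho / 2) * gamma).
split; rewrite ?mulr_gt0 ?expR_gt0//.
near=> m => theta t [_ hrho _ -> _].
have m0 : (0 < m)%N by near: m; exact: nbhs_infty_gt.
have L0 : 0 <= ln (m%:R : R) by near: m; exact: ln_natr_large.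
have [l [-> /andP[l1 l2] _]] := eta_norm_expR m0 hrho.
rewrite powRr1// -expRM; apply/andP; split.
  rewrite ler_wpM2r// ler_wpM2r ?(ltW g0)// ler_wpM2l// ler_expR.
  by move: l2; lra.
rewrite ler_wpM2r// ler_wpM2r ?(ltW g0)// ler_wpM2l// ler_expR.
by move: l1; lra.
Unshelve. all: by end_near. Qed.

Lemma polylog_Q_II_2 (gamma gamma' : R) u : 0 < gamma ->
  polylog_speed (Q_II_2 c theta0 rho gamma gamma' u).
Proof.
move=> g0; exists 2^-1, (Num.sqrt (expR (- rho / 2) * gamma)),
  (Num.sqrt (expR (rho / 2) * gamma)).
split; rewrite ?sqrtr_gt0 ?mulr_gt0 ?expR_gt0//.
near=> m => theta t [_ hrho _ -> _].
have m0 : (0 < m)%N by near: m; exact: nbhs_infty_gt.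
have L0 : 0 <= ln (m%:R : R) by near: m; exact: ln_natr_large.
have [l [-> /andP[l1 l2] _]] := eta_norm_expR m0 hrho.
have g0' := ltW g0; have p0 x : 0 <= expR x * gamma by rewrite mulr_ge0 ?expR_ge0.
have q0 x : 0 <= expR x * gamma * ln (m%:R : R) by rewrite mulr_ge0.
rewrite powR12_sqrt// -expRM -!sqrtrM// !ler_sqrt ?q0//.
apply/andP; split.
  rewrite ler_wpM2r// ler_wpM2r ?(ltW g0)// ler_expR.
  by move: l2; lra.
rewrite ler_wpM2r// ler_wpM2r ?(ltW g0)// ler_expR.
by move: l1; lra.
Unshelve. all: by end_near. Qed.

Variables (omega : R -> R).
Hypothesis L0_fin : (nef_L c theta0 < +oo)%E.
Hypothesis adm : admissible omega.
Variables (d : nat -> measure_display) (Omega : forall m, measurableType (d m))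
    (Pr : forall m, 'rV[R]_m -> probability (Omega m) R)
    (z : forall m, 'I_m -> {mfun Omega m >-> nat}).
Hypothesis expt : nef_experiment c Pr z.

Local Notation H := (nef_H c).
Local Notation H0 := (H (expR theta0)).
Local Notation c0 := (c 0%N)%:num.

Let H0_gt0 : 0 < H0. Proof. exact: nef_H_gt0. Qed.

Let invH_le theta : (nef_L c theta < +oo)%E -> 0 <= (H (expR theta))^-1 <= c0^-1.
Proof.
move=> Lf; rewrite invr_ge0 (ltW (nef_H_gt0 Lf))/= lef_pV2 ?posrE ?nef_H_gt0//.
exact: nef_H_ge.
Qed.

Lemma consistency_Q_II_1 (C gamma : R) u : 0 < C ->
  (forall k, ((c k)%:num * k`!%:R)^-1 <= C / k`!%:R) ->
  0 < gamma -> u n @[n --> \oo] --> +oo ->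
  uniform_consistency_class c theta0 omega Pr z (Q_II_1 c theta0 rho gamma u).
Proof.
move=> C0 hC g0 uy.
apply: (uniform_consistency_of_moments L0_fin adm expt uy).
- by move=> m theta t t' [_ _ _ -> _] [_ _ _ -> _].
- by move=> m theta t i [].
- by move=> m theta t [].
have [M M0 hM'] := omega_bound adm.
have hM s : -1 <= s <= 1 -> omega s <= M.
  by move=> Ds; apply: hM'; rewrite /= in_itv.
move=> kappa kappa0.
pose A := H0 ^+ 2 / c0 * (2 * M * C).
have A0 : 0 < A.
  apply: mulr_gt0; last by rewrite !mulr_gt0.
  by apply: divr_gt0 => //; exact: exprn_gt0.
(* t sqrt eta_i lies between b ln m and gamma / 2 * ln m. *)
pose b := 2^-1 * gamma * expR (- rho); have b0 : 0 < b by rewrite !mulr_gt0 ?expR_gt0.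
near=> m => theta t [hTh hrho hpi -> _].
have m0 : (0 < m)%N by near: m; exact: nbhs_infty_gt.
have L1 : 1 <= ln (m%:R : R) by near: m; exact: ln_natr_large.
have LA : A / (b * kappa) <= ln (m%:R : R) by near: m; exact: ln_natr_large.
set L := ln (m%:R : R) in L1 LA *.
have L0 : 0 < L by apply: lt_le_trans L1.
have [l [-> /andP[l1 l2] lei]] := eta_norm_expR m0 hrho.
rewrite -expRM; set t' := _ * _ * L.
have t0 : 0 < t' by rewrite !mulr_gt0 ?expR_gt0.
move: hpi; rewrite natr_powR// -/L => hpi.
set p := pi1 theta0 theta in hpi *.
have p0 : 0 < p by apply: lt_le_trans hpi; exact: expR_gt0.
have th i : - rho <= theta ord0 i.
  have := rV_entry_le theta i => h; have := le_trans h hrho.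
  by rewrite ler_norml => /andP[].
have [N hN] : exists N : nat, forall n, \sum_(N <= k < n) (t' * expR rho) ^+ k / k`!%:R
    <= kappa * p / (H0 / c0).
  apply: exp_tail_small; first by rewrite mulr_ge0 ?expR_ge0// ltW.
  by rewrite !divr_gt0// mulr_gt0.
split; [exact: ltW|by []|].
exists N, (A * (expR (gamma * L) / (b * L))), (kappa * p); split.
- move=> i; have Lf : (nef_L c (theta ord0 i) < +oo)%E by exact: nef_Theta_L.
  apply: le_trans (sqr_moment_bessel L0_fin adm Lf N t0 (ltW M0) hM hC) _.
  have /andP[i0 ile] := invH_le Lf.
  have yle : 2 * (t' * expR (theta ord0 i / 2)) <= gamma * L.
    have -> : 2 * (t' * expR (theta ord0 i / 2)) =
       gamma * L * expR (l * - 2^-1 + theta ord0 i / 2) by rewrite expRD /t'; field.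
    rewrite ler_piMr ?mulr_ge0 ?(ltW g0) ?(ltW L0)// expR_le1.
    by have := lei i; lra.
  have yge : b * L <= t' * expR (theta ord0 i / 2).
    have -> : t' * expR (theta ord0 i / 2) =
       2^-1 * gamma * expR (l * - 2^-1 + theta ord0 i / 2) * L by rewrite expRD /t'; ring.
    rewrite ler_wpM2r ?(ltW L0)// ler_wpM2l ?mulr_ge0 ?(ltW g0)// ler_expR.
    by have := th i; lra.
  apply: ler_pM.
  + apply: mulr_ge0; last by rewrite !mulr_ge0// ltW.
    by apply: mulr_ge0 => //; exact: sqr_ge0.
  + by rewrite divr_ge0 ?expR_ge0// mulr_ge0 ?expR_ge0// ltW.
  + rewrite /A ler_wpM2r//; first by rewrite !mulr_ge0// ltW.
    by rewrite ler_wpM2l ?sqr_ge0.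
  + have y0 : 0 < t' * expR (theta ord0 i / 2) by rewrite mulr_gt0 ?expR_gt0.
    apply: ler_pM; [exact: expR_ge0|by rewrite invr_ge0 ltW|by rewrite ler_expR|].
    by rewrite lef_pV2// posrE// mulr_gt0.
- move=> i n; have Lf : (nef_L c (theta ord0 i) < +oo)%E by exact: nef_Theta_L.
  have /andP[i0 ile] := invH_le Lf.
  apply: (@le_trans _ _ (H0 / c0 * \sum_(N <= k < n) (t' * expR rho) ^+ k / k`!%:R)).
    rewrite mulr_sumr; apply: ler_sum => k _.
    apply: le_trans (abs_moment_term L0_fin adm Lf (ltW t0) k) _.
    apply: ler_pM.
    + by rewrite mulr_ge0// ltW.
    + by rewrite divr_ge0// exprn_ge0// mulr_ge0 ?expR_ge0// ltW.
    + by rewrite ler_wpM2l// ltW.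
    + have te x : 0 <= t' * expR x by apply: mulr_ge0; [exact: ltW|exact: expR_ge0].
      rewrite ler_wpM2r ?invr_ge0// lerXn2r ?nnegrE ?te//.
      rewrite ler_wpM2l ?(ltW t0)// ler_expR.
      by apply: le_trans (lei i) _.
  apply: le_trans (ler_wpM2l _ (hN n)) _; first by rewrite divr_ge0// ltW.
  by rewrite mulrC divfK// gt_eqF// divr_gt0.
- have mp : expR (gamma * L) <= m%:R * p ^+ 2.
    have -> : expR (gamma * L) = m%:R * expR (L * ((gamma - 1) / 2)) ^+ 2.
      by rewrite (natr_expR R m0) -/L -expRM_natl -expRD; congr expR; field.
    by rewrite ler_wpM2l// lerXn2r ?nnegrE ?expR_ge0// ltW.
  rewrite ler_pdivrMr; last by rewrite mulr_gt0 ?ltr0n ?exprn_gt0.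
  apply: (@le_trans _ _ (kappa * expR (gamma * L))); last by rewrite ler_wpM2l// ltW.
  have -> : A * (expR (gamma * L) / (b * L)) = A / (b * L) * expR (gamma * L) by ring.
  rewrite ler_wpM2r ?expR_ge0//.
  have bL : 0 < b * L by exact: mulr_gt0.
  have bk : 0 < b * kappa by exact: mulr_gt0.
  by move: LA; rewrite !ler_pdivrMr//; lra.
- by rewrite mulfK// gt_eqF.
Unshelve. all: by end_near. Qed.

Lemma consistency_Q_II_2 (gamma gamma' : R) u : poisson_family c ->
  0 < gamma -> 0 < gamma' -> u n @[n --> \oo] --> +oo ->
  uniform_consistency_class c theta0 omega Pr z (Q_II_2 c theta0 rho gamma gamma' u).
Proof.
move=> hc g0 g'0 uy.
apply: (uniform_consistency_of_moments L0_fin adm expt uy).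
- by move=> m theta t t' [_ _ _ -> _] [_ _ _ -> _].
- by move=> m theta t i [].
- by move=> m theta t [].
have ck k : ((c k)%:num * k`!%:R)^-1 = 1 :> R.
  by rewrite hc mulVf ?invr1// pnatr_eq0 -lt0n fact_gt0.
move=> kappa kappa0.
(* Uniformly over the class, t^2 <= E ln m and t^2 eta_i <= D ln m. *)
pose E := expR rho * gamma; have E0 : 0 < E by rewrite mulr_gt0 ?expR_gt0.
pose D := E * expR rho; have D0 : 0 < D by rewrite mulr_gt0 ?expR_gt0.
(* Tilting the head by beta1 brings D down to gamma' / 4; the truncation level
   alpha ln m is such that this costs m^(gamma' / 4) up to a constant; tilting
   the tail by beta2 gains a factor m^(- 1 / 2) beyond that level. *)
pose beta1 := ln (1 + 4 * D / gamma').
have Dg0 : 0 < 4 * D / gamma' by apply: divr_gt0 => //; exact: mulr_gt0.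
have beta1_gt0 : 0 < beta1 by apply: ln_gt0; rewrite ltrDl.
have Dbeta1 : D * expR (- beta1) <= gamma' / 4.
  rewrite expRN lnK; last by rewrite posrE addr_gt0.
  rewrite ler_pdivrMr ?addr_gt0// mulrDr mulr1.
  have -> : gamma' / 4 * (4 * D / gamma') = D by field; rewrite gt_eqF.
  by rewrite lerDr ltW// divr_gt0.
pose alpha := gamma' / (4 * beta1).
have alpha0 : 0 < alpha by rewrite divr_gt0// mulr_gt0.
pose beta2 := 1 / (2 * alpha).
have beta20 : 0 < beta2 by rewrite divr_gt0// mulr_gt0.
pose F := expR (rho + beta2); have F0 : 0 < F by exact: expR_gt0.
pose A1 := H0 ^+ 2 / c0 * expR beta1.
have A10 : 0 < A1.
  by apply: mulr_gt0 (expR_gt0 _); apply: divr_gt0 => //; exact: exprn_gt0.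
pose A2 := H0 / c0; have A20 : 0 < A2 by rewrite divr_gt0.
near=> m => theta t [hTh hrho hpi -> _].
have m0 : (0 < m)%N by near: m; exact: nbhs_infty_gt.
have L1 : 1 <= ln (m%:R : R) by near: m; exact: ln_natr_large.
have LE : 16 * E * F ^+ 2 / gamma' ^+ 2 <= ln (m%:R : R) by near: m; exact: ln_natr_large.
have LA1 : 2 * A1 / (gamma' * kappa) <= ln (m%:R : R) by near: m; exact: ln_natr_large.
have LA2 : 4 * A2 / (gamma' * kappa) <= ln (m%:R : R) by near: m; exact: ln_natr_large.
set L := ln (m%:R : R) in L1 LE LA1 LA2 *.
have L0 : 0 < L by apply: lt_le_trans L1.
have gk0 : 0 < gamma' * kappa by exact: mulr_gt0.
have [l [-> /andP[l1 l2] lei]] := eta_norm_expR m0 hrho.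
rewrite -expRM.
have t2E : Num.sqrt (expR (l * - 2^-1) * gamma * L) ^+ 2 <= E * L.
  rewrite sqr_sqrtr; last by rewrite !mulr_ge0 ?expR_ge0// ltW.
  rewrite ler_wpM2r ?(ltW L0)// ler_wpM2r ?(ltW g0)// ler_expR.
  by move: l1 rho0; lra.
have t_ge0 := sqrtr_ge0 (expR (l * - 2^-1) * gamma * L).
move: (Num.sqrt _) t2E t_ge0 => t' t2E t_ge0.
move: hpi; rewrite natr_powR// -/L => hpi.
set p := pi1 theta0 theta in hpi *.
have p0 : 0 < p by apply: lt_le_trans hpi; exact: expR_gt0.
pose N := (Num.truncn (alpha * L)).+1.
have aL0 : 0 <= alpha * L by rewrite mulr_ge0// ltW.
have NL : alpha * L <= N%:R by apply: ltW; exact: truncnS_gt.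
have NU : N%:R <= alpha * L + 1.
  by rewrite /N -natr1 lerD2r truncn_le.
have tF : t' * F <= gamma' / 4 * L.
  have h0 : 0 <= gamma' / 4 * L by rewrite mulr_ge0 ?(ltW L0)// divr_ge0// ltW.
  rewrite -ler_sqr ?nnegrE //; last by rewrite mulr_ge0 ?(ltW F0).
  rewrite exprMn; apply: (@le_trans _ _ (E * L * F ^+ 2)).
    by rewrite ler_wpM2r// sqr_ge0.
  move: LE; rewrite ler_pdivrMr ?exprn_gt0// => h.
  have := ler_wpM2r (ltW L0) h; rewrite !exprMn; lra.
split; [by []|by []|].
exists N, (A1 * (expR (gamma' / 4 * L) * expR (gamma' / 4 * L))),
  (A2 * (expR (- (L / 2)) * expR (gamma' / 4 * L))); split.
- move=> i; have Lf : (nef_L c (theta ord0 i) < +oo)%E by exact: nef_Theta_L.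
  have /andP[i0 ile] := invH_le Lf.
  have q0 : 0 <= t' ^+ 2 * expR (theta ord0 i) by rewrite mulr_ge0 ?sqr_ge0 ?expR_ge0.
  have qD : t' ^+ 2 * expR (theta ord0 i) <= D * L.
    rewrite /D [leRHS]mulrAC.
    apply: ler_pM; [exact: sqr_ge0|exact: expR_ge0|exact: t2E|].
    by rewrite ler_expR; exact: le_trans (lei i) l2.
  apply: (@le_trans _ _ (H0 ^+ 2 / c0 *
      \sum_(0 <= k < N) (t' ^+ 2 * expR (theta ord0 i)) ^+ k / k`!%:R)).
    rewrite mulr_sumr; apply: ler_sum => k _.
    apply: le_trans (sqr_moment_term L0_fin adm Lf t_ge0 k) _.
    rewrite ck mul1r ler_wpM2r ?divr_ge0 ?exprn_ge0//.
    by rewrite ler_wpM2l ?sqr_ge0.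
  rewrite /A1 -(mulrA (H0 ^+ 2 / c0)); apply: ler_wpM2l; first by rewrite divr_ge0 ?sqr_ge0.
  apply: le_trans (exp_head_le N q0 (ltW beta1_gt0)) _.
  rewrite [leRHS]mulrA -[X in _ <= X * _]expRD.
  apply: ler_pM; rewrite ?expR_ge0// ler_expR.
    apply: le_trans (ler_wpM2l (ltW beta1_gt0) NU) _.
    have -> : beta1 * (alpha * L + 1) = beta1 + gamma' / 4 * L.
      by rewrite /alpha; field; rewrite gt_eqF.
    by [].
  apply: le_trans (ler_wpM2r (expR_ge0 _) qD) _.
  by rewrite mulrAC ler_wpM2r// ltW.
- move=> i n; have Lf : (nef_L c (theta ord0 i) < +oo)%E by exact: nef_Theta_L.
  have /andP[i0 ile] := invH_le Lf.
  have te0 : 0 <= t' * expR (theta ord0 i) by rewrite mulr_ge0 ?expR_ge0.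
  apply: (@le_trans _ _ (A2 *
      \sum_(N <= k < n) (t' * expR (theta ord0 i)) ^+ k / k`!%:R)).
    rewrite mulr_sumr; apply: ler_sum => k _.
    apply: le_trans (abs_moment_term L0_fin adm Lf t_ge0 k) _.
    rewrite ler_wpM2r ?divr_ge0 ?exprn_ge0//.
    by rewrite ler_wpM2l// ltW.
  apply: ler_wpM2l; first exact: ltW.
  apply: le_trans (exp_tail_le N n te0 (ltW beta20)) _.
  apply: ler_pM; rewrite ?expR_ge0// ler_expR.
    rewrite lerN2; apply: le_trans (ler_wpM2l (ltW beta20) NL).
    by rewrite le_eqVlt; apply/orP; left; apply/eqP; rewrite /beta2; field; rewrite gt_eqF.
  apply: le_trans tF; rewrite -mulrA -expRD ler_wpM2l// ler_expR lerD2r.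
  exact: le_trans (lei i) l2.
- have mp : expR (gamma' * L) <= m%:R * p ^+ 2.
    have -> : expR (gamma' * L) = m%:R * expR (L * ((gamma' - 1) / 2)) ^+ 2.
      by rewrite (natr_expR R m0) -/L -expRM_natl -expRD; congr expR; field.
    by rewrite ler_wpM2l// lerXn2r ?nnegrE ?expR_ge0// ltW.
  rewrite ler_pdivrMr; last by rewrite mulr_gt0 ?ltr0n ?exprn_gt0.
  apply: (@le_trans _ _ (kappa * expR (gamma' * L))); last by rewrite ler_wpM2l// ltW.
  have -> : expR (gamma' / 4 * L) * expR (gamma' / 4 * L) = expR (gamma' / 2 * L).
    by rewrite -expRD; congr expR; field.
  have -> : expR (gamma' * L) = expR (gamma' / 2 * L) * expR (gamma' / 2 * L).
    by rewrite -expRD; congr expR; field.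
  rewrite mulrA ler_wpM2r ?expR_ge0//.
  apply: (@le_trans _ _ (kappa * (gamma' / 2 * L))).
    by move: LA1; rewrite ler_pdivrMr//; lra.
  rewrite ler_wpM2l ?(ltW kappa0)//; apply: le_trans (expR_ge1Dx _).
  by rewrite lerDr.
- rewrite ler_pdivrMr//.
  apply: (@le_trans _ _ (kappa * expR (L * ((gamma' - 1) / 2)))); last first.
    by rewrite ler_wpM2l// ltW.
  have -> : expR (L * ((gamma' - 1) / 2)) =
      expR (gamma' / 4 * L) * (expR (- (L / 2)) * expR (gamma' / 4 * L)).
    by rewrite -!expRD; congr expR; field.
  have ee0 : 0 <= expR (- (L / 2)) * expR (gamma' / 4 * L) by rewrite mulr_ge0 ?expR_ge0.
  rewrite [leRHS]mulrA ler_wpM2r//.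
  apply: (@le_trans _ _ (kappa * (gamma' / 4 * L))).
    by move: LA2; rewrite ler_pdivrMr//; lra.
  rewrite ler_wpM2l ?(ltW kappa0)//; apply: le_trans (expR_ge1Dx _).
  by rewrite lerDr.
Unshelve. all: by end_near. Qed.

End Classes.

Theorem theorem7 (R : realType) (c : nat -> {posnum R})
    (theta0 : R) (omega : R -> R) (rho : R)
    (d : nat -> measure_display) (Omega : forall m, measurableType (d m))
    (Pr : forall m, 'rV[R]_m -> probability (Omega m) R)
    (z : forall m, 'I_m -> {mfun Omega m >-> nat}) :
  nef_Theta c theta0 ->
  admissible omega ->
  0 < rho ->
  nef_experiment c Pr z ->
  ((exists2 C : R, 0 < C &
       forall k : nat, ((c k)%:num * k`!%:R)^-1 <= C / k`!%:R) ->
     forall (gamma : R) (u : nat -> R), 0 < gamma <= 1 ->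
       u n @[n --> \oo] --> +oo ->
       uniform_consistency_class c theta0 omega Pr z
         (Q_II_1 c theta0 rho gamma u) /\
       polylog_speed (Q_II_1 c theta0 rho gamma u))
  /\
  (poisson_family c ->
     forall (gamma gamma' : R) (u : nat -> R), 0 < gamma < 1 ->
       gamma < gamma' ->
       u n @[n --> \oo] --> +oo ->
       uniform_consistency_class c theta0 omega Pr z
         (Q_II_2 c theta0 rho gamma gamma' u) /\
       polylog_speed (Q_II_2 c theta0 rho gamma gamma' u)).
Proof.
move=> /nef_Theta_L L0_fin adm rho0 expt; split.
  move=> [C C0 hC] gamma u /andP[g0 _] uy; split.
    exact: (consistency_Q_II_1 rho L0_fin adm expt C0 hC g0 uy).
  exact: polylog_Q_II_1.
move=> hc gamma gamma' u /andP[g0 _] gg' uy; split; last exact: polylog_Q_II_2.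
apply: (consistency_Q_II_2 rho0 L0_fin adm expt hc g0 _ uy).
exact: lt_trans gg'.
Qed.
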